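(* Let $\{Y_k\}$ be a fourth-order stationary sequence with $EY_k=0$, autocovariances $\gamma_j=\mathrm{Cov}(Y_0,Y_j)$ and fourth-order cumulants $\kappa(h,r,s)$, satisfying: (a) $n^{-1/2}\sum_{1\le j\le nt}Y_j\xrightarrow{d}\sigma W(t)$ in $D[0,1]$ for some $\sigma>0$, $W$ a standard Wiener process; (b) $\sum_j|\gamma_j|<\infty$; (c) $\sup_h\sum_{r,s}|\kappa(h,r,s)|<\infty$. Let $X_i=\mu+Y_i$, $1\le i\le n$, for a constant $\mu$. Suppose $q(n)\to\infty$ and $q(n)/n\to0$. Then $$T_n\xrightarrow{d}\sup_{0\le t\le1}|B(t)|,$$ where $B$ is a Brownian bridge.
   Context: A sequence is fourth-order stationary if it has finite fourth moments and its joint moments of order at most four are shift invariant; $\kappa(h,r,s)=E[Y_kY_{k+h}Y_{k+r}Y_{k+s}]-(\gamma_h\gamma_{r-s}+\gamma_r\gamma_{h-s}+\gamma_s\gamma_{h-r})$. $q(n)$ is a sequence of positive integers, $\omega_j(q)=1-j/(q+1)$, $\bar X_n=\frac1n\sum_{i\le n}X_i$, $\hat\gamma_j=\frac1n\sum_{1\le i\le n-j}(X_i-\bar X_n)(X_{i+j}-\bar X_n)$, $s_n^2=\hat\gamma_0+2\sum_{1\le j\le q(n)}\omega_j(q(n))\hat\gamma_j$, and $T_n=\frac1{n^{1/2}s_n}\max_{1\le k\le n}|\sum_{1\le i\le k}X_i-\frac kn\sum_{1\le i\le n}X_i|$. *)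

(* Defs.v *)
From HB Require Import structures.
From mathcomp Require Import all_boot all_order all_algebra.
From mathcomp Require Import all_classical all_reals all_analysis.
Set Implicit Arguments.
Unset Strict Implicit.
Unset Printing Implicit Defensive.
Import Order.TTheory GRing.Theory Num.Theory.
Import numFieldNormedType.Exports.
Local Open Scope classical_set_scope.
Local Open Scope ring_scope.

Section probability_defs.
Context {R : realType} {d : measure_display} {Omega : measurableType d}.
Variable P : probability Omega R.

Definition Ex (f : Omega -> R) : \bar R := (\int[P]_w (f w)%:E)%E.

Definition is_normal (Z : Omega -> R) (m v : R) : Prop :=
  forall A : set R, measurable A ->
    P (Z @^-1` A) = if v == 0 then \d_m A else normal_prob m (Num.sqrt v) A.

Definition gaussian_process01 (G : R -> Omega -> R) (c : R -> R -> R) : Prop :=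
  (forall t, measurable_fun setT (G t)) /\
  forall (n : nat) (a t : 'I_n -> R), (forall i, t i \in `[0, 1]) ->
    is_normal (fun w => \sum_(i < n) a i * G (t i) w) 0
              (\sum_(i < n) \sum_(j < n) a i * a j * c (t i) (t j)).

Definition wiener_process01 (W : R -> Omega -> R) : Prop :=
  gaussian_process01 W (fun s t => Num.min s t) /\
  forall w, {within `[0, 1], continuous (fun t => W t w)}.

Definition brownian_bridge01 (B : R -> Omega -> R) : Prop :=
  gaussian_process01 B (fun s t => Num.min s t - s * t) /\
  forall w, {within `[0, 1], continuous (fun t => B t w)}.

Definition fourth_order_stationary (Y : int -> Omega -> R) : Prop :=
  (forall k, measurable_fun setT (Y k)) /\
  (forall k, P.-integrable setT (fun w => (Y k w ^+ 4)%:E)) /\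
  forall k m h r s : int,
    [/\ Ex (Y k) = Ex (Y m),
        Ex (fun w => Y k w * Y (k + h) w) = Ex (fun w => Y m w * Y (m + h) w),
        Ex (fun w => Y k w * Y (k + h) w * Y (k + r) w)
          = Ex (fun w => Y m w * Y (m + h) w * Y (m + r) w) &
        Ex (fun w => Y k w * Y (k + h) w * Y (k + r) w * Y (k + s) w)
          = Ex (fun w => Y m w * Y (m + h) w * Y (m + r) w * Y (m + s) w)].

(** autocovariances (the sequence is centered) *)
Definition gamma (Y : int -> Omega -> R) (j : int) : R :=
  fine (Ex (fun w => Y 0 w * Y j w)).

Definition kappa (Y : int -> Omega -> R) (h r s : int) : R :=
  fine (Ex (fun w => Y 0 w * Y h w * Y r w * Y s w))
  - (gamma Y h * gamma Y (r - s) + gamma Y r * gamma Y (h - s)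
     + gamma Y s * gamma Y (h - r)).

Definition partial_sum_process (Y : int -> Omega -> R) (n : nat) (t : R)
  (w : Omega) : R :=
  (Num.sqrt n%:R)^-1 * \sum_(1 <= j < (Num.truncn (n%:R * t)).+1) Y j%:Z w.

Section statistic.
Variables (mu : R) (Y : int -> Omega -> R) (q : nat -> nat).
Definition Xs (i : nat) (w : Omega) : R := mu + Y i%:Z w.
Definition Xbar (n : nat) (w : Omega) : R :=
  n%:R^-1 * \sum_(1 <= i < n.+1) Xs i w.
Definition gammahat (n j : nat) (w : Omega) : R :=
  n%:R^-1 * \sum_(1 <= i < (n - j).+1)
              (Xs i w - Xbar n w) * (Xs (i + j) w - Xbar n w).
Definition omega_w (qq j : nat) : R := 1 - j%:R / (qq.+1)%:R.
Definition s2 (n : nat) (w : Omega) : R :=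
  gammahat n 0 w
  + 2 * \sum_(1 <= j < (q n).+1) omega_w (q n) j * gammahat n j w.
Definition Tn (n : nat) (w : Omega) : R :=
  (Num.sqrt n%:R * Num.sqrt (s2 n w))^-1 *
  \big[Num.max/0]_(1 <= k < n.+1)
     `|\sum_(1 <= i < k.+1) Xs i w - k%:R / n%:R * \sum_(1 <= i < n.+1) Xs i w|.
End statistic.

End probability_defs.

Section space_defs.
Context {R : realType}.

(** D[0,1]: cadlag functions on [0,1] (values outside [0,1] are irrelevant) *)
Definition cadlag01 (x : R -> R) : Prop :=
  (forall t, 0 <= t < 1 -> x @ t^'+ --> x t) /\
  (forall t, 0 < t <= 1 -> cvg (x @ t^'-)).

Definition time_change01 (l : R -> R) : Prop :=
  [/\ l 0 = 0, l 1 = 1,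
      {within `[0, 1], continuous l} &
      forall s t, s \in `[0, 1] -> t \in `[0, 1] -> s < t -> l s < l t].

(** Skorokhod J1 distance d(x, y) < delta, i.e.
    inf_l max(sup_t |l t - t|, sup_t |x t - y (l t)|) < delta *)
Definition sk_lt (x y : R -> R) (delta : R) : Prop :=
  exists l e, [/\ time_change01 l, e < delta &
    forall t, t \in `[0, 1] -> `|l t - t| <= e /\ `|x t - y (l t)| <= e].

Definition sk_bounded_continuous (f : (R -> R) -> R) : Prop :=
  (exists M, forall x, cadlag01 x -> `|f x| <= M) /\
  forall x, cadlag01 x -> forall e, 0 < e ->
    exists2 delta, 0 < delta &
      forall y, cadlag01 y -> sk_lt x y delta -> `|f x - f y| < e.

Definition weak_conv_D {d1 d2 : measure_display}
  {O1 : measurableType d1} {O2 : measurableType d2}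
  (P : probability O1 R) (S : nat -> R -> O1 -> R)
  (Q : probability O2 R) (Z : R -> O2 -> R) : Prop :=
  forall f, sk_bounded_continuous f ->
    (fun n => (\int[P]_w (f (fun t => S n t w))%:E)%E) @ \oo -->
    (\int[Q]_w (f (fun t => Z t w))%:E)%E.

Definition conv_dist {d1 d2 : measure_display}
  {O1 : measurableType d1} {O2 : measurableType d2}
  (P : probability O1 R) (T : nat -> O1 -> R)
  (Q : probability O2 R) (Z : O2 -> R) : Prop :=
  forall g : R -> R, continuous g -> (exists M, forall x, `|g x| <= M) ->
    (fun n => (\int[P]_w (g (T n w))%:E)%E) @ \oo -->
    (\int[Q]_w (g (Z w))%:E)%E.

Definition abs_summable_int (a : int -> R) : Prop :=
  exists M, forall N : nat,
    \sum_(i < (N + N).+1) `|a (i%:Z - N%:Z)| <= M.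

End space_defs.

(* Main.v *)
Require Import Defs.
From HB Require Import structures.
From mathcomp Require Import all_boot all_order all_algebra.
From mathcomp Require Import ring lra zify.
From mathcomp Require Import all_classical all_reals all_analysis measurable_realfun.
Set Implicit Arguments.
Unset Strict Implicit.
Unset Printing Implicit Defensive.
Import Order.TTheory GRing.Theory Num.Theory.
Import numFieldNormedType.Exports.
Local Open Scope classical_set_scope.
Local Open Scope ring_scope.

(** The numerator of T_n is, up to |S_n(1)|/n, the functional sup |x(t) - t x(1)| of
the partial sum process S_n. This functional is Skorokhod continuous, so by (a) it
converges in law to sigma sup |W(t) - t W(1)|. The latter has the law of
sigma sup |B(t)|: the Gaussian linear combinations of the two processes agree, and
polynomials in cosines of linear forms approximate, through bounded pointwise limits,
the indicator of {sup_i |x_i| <= c}.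

For the denominator, (b) and (c) bound E(Y_1 + ... + Y_n)^4 by C n^2. Hence S_n(1)^2 is
uniformly integrable, and v_n = E S_n(1)^2 tends to sigma^2. The Bartlett weights make
the mean of s_n^2 equal to v_(q+1) up to O(q/n), because
v_N = gamma_0 + 2 sum_(1 <= j < N) (1 - j/N) gamma_j, and the variance of s_n^2 with known
mean mu is O(q/n) by summing the fourth moments. So s_n^2 tends to sigma^2 in L^1, and
a Slutsky argument concludes. *)

(** The constant sigma of (a) has no a priori link with the autocovariances, and convergence in law
    alone does not carry second moments: hence the uniform integrability, and hence the limit of
    v_(q+1) is never written as a sum of the gamma_j. The Gaussian hypotheses concern only
    one-dimensional laws of linear combinations, while the supremum depends on infinitely many
    coordinates. Path regularity reduces it to rational times; the events are symmetric, so cosines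
    are enough, and a product of cosines of linear forms is again a combination of such cosines. All
    error bounds are kept linear in L^1 quantities: a truncation loss is at most x^4/K, a
    fluctuation |x| at most x^2/e + e, and a deviation beyond delta is charged to the distance
    divided by delta. For the variance of s_n^2, condition (c) allows summing over two indices with
    the two others fixed; a lag and a position give about n q fixed pairs against a prefactor n^-2.
    Since g is uniformly continuous only on compacts, the Slutsky step needs tightness, which is
    taken from the limit law. *)

(** * Real-valued expectation and dominated convergence *)

Section expectation.
Context {R : realType} {d : measure_display} {T : measurableType d}.
Variable P : probability T R.
Implicit Types f g : T -> R.

Definition L1 f := P.-integrable setT (EFin \o f).
(** Outside [L1] this may be the [fine] of an infinite value; hence the [L1] side conditions of the
    algebraic rules. *)
Definition EE f : R := \int[P]_w f w.

Lemma L1_measurable f : L1 f -> measurable_fun setT f.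
Proof. by move=> /measurable_int /measurable_EFinP. Qed.

Lemma L1_le f g : measurable_fun setT f -> L1 g ->
  (forall w, `|f w| <= g w) -> L1 f.
Proof.
move=> mf ig fg; apply: (le_integrable measurableT _ _ ig).
  exact/measurable_EFinP.
by move=> w _ /=; rewrite lee_fin (le_trans (fg w))// ler_norm.
Qed.

Lemma L1_cst (c : R) : L1 (fun=> c).
Proof. exact: finite_measure_integrable_cst. Qed.

Lemma L1_bounded f M : measurable_fun setT f -> (forall w, `|f w| <= M) -> L1 f.
Proof. by move=> mf fM; apply: (L1_le mf (L1_cst M)). Qed.

Lemma L1D f g : L1 f -> L1 g -> L1 (fun w => f w + g w).
Proof. by move=> /(integrableD measurableT) h /h; apply: eq_integrable. Qed.

Lemma L1Z c f : L1 f -> L1 (fun w => c * f w).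
Proof. by move=> /(integrableZl measurableT c); apply: eq_integrable. Qed.

Lemma L1Zr c f : L1 f -> L1 (fun w => f w * c).
Proof. by move=> /(L1Z c); under eq_fun do rewrite mulrC. Qed.

Lemma L1B f g : L1 f -> L1 g -> L1 (fun w => f w - g w).
Proof. by move=> /(integrableB measurableT) h /h; apply: eq_integrable. Qed.

Lemma L1_abs f : L1 f -> L1 (fun w => `|f w|).
Proof. by move=> /integrable_norm; apply. Qed.

Lemma L1_sum I (s : seq I) (p : pred I) (F : I -> T -> R) :
  (forall i, L1 (F i)) -> L1 (fun w => \sum_(i <- s | p i) F i w).
Proof.
move=> LF; elim: s => [|i s IH].
  by under eq_fun do rewrite big_nil; exact: L1_cst.
under eq_fun do rewrite big_cons.
by case: (p i) => //; apply: L1D.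
Qed.

Lemma EE_cst (c : R) : EE (fun=> c) = c.
Proof. by rewrite /EE Rintegral_cst// [X in fine X](@probability_setT _ _ _ P) mulr1. Qed.

Lemma EED f g : L1 f -> L1 g -> EE (fun w => f w + g w) = EE f + EE g.
Proof. by move=> *; apply: RintegralD. Qed.

Lemma EEB f g : L1 f -> L1 g -> EE (fun w => f w - g w) = EE f - EE g.
Proof. by move=> *; apply: RintegralB. Qed.

Lemma EEZ c f : L1 f -> EE (fun w => c * f w) = c * EE f.
Proof. by move=> *; apply: RintegralZl. Qed.

Lemma EEZr c f : L1 f -> EE (fun w => f w * c) = EE f * c.
Proof. by move=> *; apply: RintegralZr. Qed.

Lemma EE_sum I (s : seq I) (p : pred I) (F : I -> T -> R) :
  (forall i, L1 (F i)) ->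
  EE (fun w => \sum_(i <- s | p i) F i w) = \sum_(i <- s | p i) EE (F i).
Proof.
move=> LF; elim: s => [|i s IH].
  by under eq_fun do rewrite big_nil; rewrite big_nil EE_cst.
rewrite big_cons -IH; under eq_fun do rewrite big_cons.
by case: (p i) => //; rewrite EED//; apply: L1_sum.
Qed.

Lemma EE_le f g : L1 f -> L1 g -> (forall w, f w <= g w) -> EE f <= EE g.
Proof. by move=> *; apply: le_Rintegral. Qed.

Lemma EE_ge0 f : (forall w, 0 <= f w) -> 0 <= EE f.
Proof. by move=> *; apply: Rintegral_ge0. Qed.

Lemma EE_abs_le f : L1 f -> `|EE f| <= EE (fun w => `|f w|).
Proof. by move=> *; apply: le_normr_Rintegral. Qed.

Lemma eq_EE f g : f =1 g -> EE f = EE g.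
Proof. by move=> /funext ->. Qed.

Lemma EFin_EE f : L1 f -> (\int[P]_w (f w)%:E)%E = (EE f)%:E.
Proof. by move=> Lf; rewrite /EE /Rintegral fineK//; apply: integrable_fin_num. Qed.

(** The pointwise limit inherits measurability, and the bound passes to it, so nothing has to be
    assumed of [f] itself. *)
Lemma EE_dominated_cvg (f_ : nat -> T -> R) f g :
  (forall n, measurable_fun setT (f_ n)) -> L1 g ->
  (forall n w, `|f_ n w| <= g w) ->
  (forall w, f_ n w @[n --> \oo] --> f w) ->
  EE (f_ n) @[n --> \oo] --> EE f.
Proof.
move=> mf_ Lg fg cf.
have mf : measurable_fun setT f.
  by apply: (measurable_fun_cvg mf_) => w _; apply: cf.
have Lf : L1 f.
  apply: (L1_le mf Lg) => w.
  rewrite -(cvg_lim _ (cvg_norm (cf w)))//; apply: limr_le.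
    by apply/cvg_ex; eexists; apply: cvg_norm; apply: cf.
  by apply: nearW => n; apply: fg.
have h : (\int[P]_w (f_ n w)%:E)%E @[n --> \oo] --> (\int[P]_w (f w)%:E)%E.
  apply: (@dominated_cvg _ _ _ P setT measurableT (fun n w => (f_ n w)%:E)
    (fun w => (f w)%:E) (fun w => (g w)%:E)) => //.
  - by move=> n; apply/measurable_EFinP.
  - by move=> w _; apply/cvg_EFin; [exact: nearW|exact: cf].
  - by move=> n w _; rewrite lee_fin.
apply/fine_cvg; rewrite -EFin_EE//.
Qed.

Lemma EE_bounded_cvg (f_ : nat -> T -> R) f M :
  (forall n, measurable_fun setT (f_ n)) ->
  (forall n w, `|f_ n w| <= M) ->
  (forall w, f_ n w @[n --> \oo] --> f w) ->
  EE (f_ n) @[n --> \oo] --> EE f.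
Proof. by move=> mf fM; apply: (EE_dominated_cvg mf (L1_cst M)). Qed.

End expectation.

(** * Suprema over [0,1] and Skorokhod continuity *)

Section sup_unit_interval.
Context {R : realType}.
Implicit Types (f g x y : R -> R) (A B : set R).

Definition sup01 f : R := sup [set f t | t in `[0, 1]].
Definition rcont01 f := forall t, 0 <= t < 1 -> f s @[s --> t^'+] --> f t.
Definition ub01 f := exists M, forall t, 0 <= t <= 1 -> f t <= M.

(* When the two sets are unbounded both suprema are the junk value 0. *)
Lemma sup_dist_le A B c : 0 <= c -> A !=set0 -> B !=set0 ->
  (forall a, A a -> exists2 b, B b & a <= b + c) ->
  (forall b, B b -> exists2 a, A a & b <= a + c) -> `|sup A - sup B| <= c.
Proof.
move=> c0 A0 B0 AB BA.
have tr C D : (forall b, D b -> exists2 a, C a & b <= a + c) ->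
    has_ubound C -> has_ubound D.
  move=> CD [M CM]; exists (M + c) => b /CD[a Ca] /le_trans; apply.
  by rewrite lerD2r; apply: CM.
have le C D : C !=set0 -> (forall a, C a -> exists2 b, D b & a <= b + c) ->
    has_ubound D -> sup C <= sup D + c.
  move=> C0 CD uD; apply: ge_sup => // a /CD[b Db] /le_trans; apply.
  by rewrite lerD2r; apply: ub_le_sup.
have [uA|nuA] := pselect (has_ubound A).
  have uB := tr _ _ BA uA.
  by rewrite ler_distl lerBlDr (le _ _ B0)//= (le _ _ A0).
have nuB : ~ has_ubound B by move=> /(tr _ _ AB).
by rewrite !sup_out ?subrr ?normr0//; case.
Qed.

Lemma time_change01_range (l : R -> R) t : time_change01 l -> t \in `[0, 1] ->
  l t \in `[0, 1].
Proof.
move=> [l0 l1 _ lm]; rewrite !in_itv/= => /andP[t0 t1]; apply/andP; split.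
  move: t0; rewrite le_eqVlt => /predU1P[<-|t0]; first by rewrite l0.
  by rewrite -[leLHS]l0 ltW// lm ?in_itv/= ?lexx ?ler01 ?t1 ?ltW.
move: t1; rewrite le_eqVlt => /predU1P[->|t1]; first by rewrite l1.
by rewrite -[leRHS]l1 ltW// lm ?in_itv/= ?lexx ?ler01 ?t0 ?ltW.
Qed.

Lemma time_change01_surj (l : R -> R) s : time_change01 l -> s \in `[0, 1] ->
  exists2 t, t \in `[0, 1] & l t = s.
Proof.
move=> [l0 l1 lc _]; rewrite in_itv/= => s01; apply: IVT => //.
by rewrite l0 l1 min_l ?max_r// ler01.
Qed.

Definition bridge x t : R := `|x t - t * x 1|.

(** A time change is a bijection of [0, 1] fixing 1, so the two bridges can be matched at [t] and
    [l t], and [x 1] is compared with [y 1] itself. The three errors are [e], [e * |x 1|] and [e].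
    The constant depends on [x 1], which continuity at a fixed [x] tolerates. *)
Lemma bridge_sup_sk_lt x y delta : sk_lt x y delta ->
  `|sup01 (bridge x) - sup01 (bridge y)| <= delta * (2 + `|x 1|).
Proof.
move=> [l [e [lt ed H]]].
have [l0 l1 _ _] := lt.
have i0 : (0 : R) \in `[0, 1] by rewrite in_itv/= lexx ler01.
have i1 : (1 : R) \in `[0, 1] by rewrite in_itv/= lexx ler01.
have e0 : 0 <= e by have [+ _] := H _ i0; apply: le_trans.
have d0 : 0 <= delta by rewrite ltW// (le_lt_trans e0).
have [_ H1] := H _ i1; rewrite l1 in H1.
have c0 : 0 <= delta * (2 + `|x 1|) by rewrite mulr_ge0// addr_ge0.
have key t : t \in `[0, 1] ->
    `|(x t - t * x 1) - (y (l t) - l t * y 1)| <= delta * (2 + `|x 1|).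
  move=> ti; have [Ht Hx] := H _ ti.
  have := time_change01_range lt ti; rewrite in_itv/= => /andP[lt0 lt1].
  have -> : (x t - t * x 1) - (y (l t) - l t * y 1) =
    (x t - y (l t)) + ((l t - t) * x 1 - l t * (x 1 - y 1)) by ring.
  apply: (le_trans (ler_normD _ _)).
  apply: (@le_trans _ _ (e + (e * `|x 1| + e))).
    apply: lerD => //; apply: (le_trans (ler_normB _ _)).
    rewrite !normrM; apply: lerD; first exact: ler_wpM2r.
    by rewrite -[leRHS]mul1r ler_pM// ger0_norm.
  rewrite (_ : e + _ = e * (2 + `|x 1|)); last by ring.
  by rewrite ler_wpM2r ?addr_ge0// ltW.
apply: sup_dist_le => //.
- by exists (bridge x 0); exists 0.
- by exists (bridge y 0); exists 0.
- move=> _ [t ti <-]; exists (bridge y (l t)).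
    by exists (l t) => //; apply: time_change01_range.
  rewrite -lerBlDl; apply: le_trans (key _ ti).
  exact: lerB_dist.
- move=> _ [s si <-]; have [t ti <-] := time_change01_surj lt si.
  exists (bridge x t); first by exists t.
  rewrite -lerBlDl; apply: le_trans (key _ ti).
  by rewrite distrC; apply: lerB_dist.
Qed.

Lemma sk_bounded_continuous_bridge_sup (g : R -> R) : continuous g ->
  (exists M, forall r, `|g r| <= M) ->
  sk_bounded_continuous (fun x => g (sup01 (bridge x))).
Proof.
move=> cg [M gM]; split; first by exists M => x _.
move=> x _ e e0.
have /cvgrPdist_lt/(_ _ e0)[eta /= eta0 Heta] := cg (sup01 (bridge x)).
have c0 : 0 < 2 + `|x 1| by rewrite ltr_pwDl.
(* Halving turns the non-strict bound of [bridge_sup_sk_lt] into a strict one. *)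
exists (eta / (2 + `|x 1|) / 2); first by rewrite !divr_gt0.
move=> y _ /bridge_sup_sk_lt h; apply: Heta; rewrite /ball_/=.
apply: (le_lt_trans h); rewrite mulrAC divfK ?gt_eqF//.
by rewrite ltr_pdivrMr// ltr_pMr// ltr1n.
Qed.

Lemma sk_bounded_continuous_eval1 (g : R -> R) : continuous g ->
  (exists M, forall r, `|g r| <= M) ->
  sk_bounded_continuous (fun x => g (x 1)).
Proof.
move=> cg [M gM]; split; first by exists M => x _.
move=> x _ e e0.
have /cvgrPdist_lt/(_ _ e0)[eta /= eta0 Heta] := cg (x 1).
exists eta => // y _ [l [e' [[_ l1 _ _] ed H]]]; apply: Heta; rewrite /ball_/=.
have [|_] := H 1; first by rewrite in_itv/= lexx ler01.
by rewrite l1 => /le_lt_trans; apply.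
Qed.

(** An enumeration of the rationals of [0, 1]; every other code is sent to 1, which keeps all values
    in the interval. *)
Definition q01 (i : nat) : R :=
  if unpickle i is Some q then
    if 0 <= (ratr q : R) <= 1 then ratr q else 1
  else 1.

Lemma q01_itv i : 0 <= q01 i <= 1.
Proof. by rewrite /q01; case: unpickle => [q|]; [case: ifP|]; rewrite ?lexx ?ler01. Qed.

Lemma q01_dense a b : 0 <= a -> a < b -> b <= 1 -> exists i, a < q01 i < b.
Proof.
move=> a0 ab b1; have [q] := rat_in_itvoo ab.
rewrite in_itv/= => /andP[aq qb]; exists (pickle q).
by rewrite /q01 pickleK (le_trans a0 (ltW aq)) (le_trans (ltW qb) b1)/= aq.
Qed.

Lemma q01_1 : exists i, q01 i = 1.
Proof. by exists (pickle (1 : rat)); rewrite /q01 pickleK rmorph1 lexx ler01. Qed.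

Lemma has_ub01 f : ub01 f -> has_ubound [set f t | t in `[0, 1]].
Proof. by move=> [M fM]; exists M => _ [t + <-] => /=; rewrite in_itv; apply: fM. Qed.

Lemma sup01_ub f t : ub01 f -> 0 <= t <= 1 -> f t <= sup01 f.
Proof.
by move=> /has_ub01 fM t01; apply: ub_le_sup => //; exists t => //=.
Qed.

Lemma sup01_le f c : (forall t, 0 <= t <= 1 -> f t <= c) -> sup01 f <= c.
Proof.
move=> fc; apply: ge_sup.
  by exists (f 0); exists 0 => //=; rewrite in_itv/= lexx ler01.
by move=> _ [t + <-] => /=; rewrite in_itv; apply: fc.
Qed.

(** If [f t > c] with [t < 1], right continuity keeps [f > c] on a short interval after [t], which
    meets the dense sequence; the endpoint 1 has no right neighbourhood in the interval and has to
    be a term of the sequence itself. *)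
Lemma sup01_leP f c : ub01 f -> rcont01 f ->
  sup01 f <= c <-> forall i, f (q01 i) <= c.
Proof.
move=> fM fr; split=> [fc i|fc].
  by apply: le_trans fc; apply: sup01_ub => //; apply: q01_itv.
apply: sup01_le => t /andP[t0]; rewrite le_eqVlt => /predU1P[->|t1].
  by have [i <-] := q01_1.
rewrite leNgt; apply/negP => ct.
have /fr h : 0 <= t < 1 by rewrite t0.
have [e /= e0 He] := cvgr_gt _ h _ ct.
have [i] : exists i, t < q01 i < Num.min 1 (t + e).
  by apply: q01_dense; rewrite // ?lt_min ?t1 ?ltrDl// ge_min lexx.
rewrite lt_min => /and3P[ti i1 ie].
have := He (q01 i); rewrite /= distrC gtr0_norm ?subr_gt0// ltrBlDl => /(_ ie ti).
by rewrite ltNge fc.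
Qed.

Lemma continuous_ub01 f : {within `[0, 1], continuous f} -> ub01 f.
Proof.
move=> /(EVT_max (@ler01 R))[c _ H]; exists (f c) => t t01; apply: H.
by rewrite in_itv.
Qed.

Lemma continuous_rcont01 f : {within `[0, 1], continuous f} -> rcont01 f.
Proof.
move=> /(continuous_within_itvP _ ltr01)[ci c0 _] t /andP[].
rewrite le_eqVlt => /predU1P[<-//|t0 t1].
by apply: cvg_at_right_filter; apply: ci; rewrite in_itv/= t0.
Qed.

Lemma rcont01_bridge x : rcont01 x -> rcont01 (bridge x).
Proof.
move=> xr t t01; apply: cvg_norm; apply: cvgB; first exact: xr.
by apply: cvgMr_tmp; apply: cvg_at_right_filter; exact: cvg_id.
Qed.

Lemma ub01_bridge x : ub01 (fun t => `|x t|) -> ub01 (bridge x).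
Proof.
move=> [M xM]; exists (M + M) => t t01; apply: (le_trans (ler_normB _ _)).
apply: lerD; first exact: xM.
have /andP[t0 t1] := t01.
rewrite normrM ger0_norm//; apply: (@le_trans _ _ (1 * `|x 1|)).
  exact: ler_wpM2r.
by rewrite mul1r xM// lexx ler01.
Qed.

Lemma measurable_sup01 d (T : measurableType d) (F : R -> T -> R) :
  (forall t, measurable_fun setT (F t)) ->
  (forall w, ub01 (F^~ w)) -> (forall w, rcont01 (F^~ w)) ->
  measurable_fun setT (fun w => sup01 (F^~ w)).
Proof.
move=> mF uF rF; apply: (measurability (@RGenOInfty.G R)).
  exact: RGenOInfty.measurableE.
move=> /= _ [_] [c ->] <-; rewrite setTI.
rewrite (_ : _ @^-1` _ = \bigcup_i (F (q01 i) @^-1` `]c, +oo[)).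
  apply: bigcup_measurable => i _; rewrite -[X in measurable X]setTI.
  exact: mF.
apply/seteqP; split=> w /=; rewrite in_itv/= andbT => H.
  apply: contrapT => H'; move: H; apply/negP; rewrite -leNgt.
  apply/sup01_leP => // i; rewrite leNgt; apply/negP => h; apply: H'.
  by exists i => //=; rewrite in_itv/= h.
case: H => i _ /=; rewrite in_itv/= andbT => /lt_le_trans; apply.
by apply: sup01_ub => //; apply: q01_itv.
Qed.

End sup_unit_interval.

(** * Expectations determined by the law on the real line *)

Section equality_in_law.
Context {R : realType} {d1 d2 : measure_display}.
Context {T1 : measurableType d1} {T2 : measurableType d2}.
Variables (P1 : probability T1 R) (P2 : probability T2 R).

Lemma eq_preimage_EE (Z1 : T1 -> R) (Z2 : T2 -> R) (g : R -> R) (M : R) :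
  measurable_fun setT Z1 -> measurable_fun setT Z2 ->
  (forall A, measurable A -> P1 (Z1 @^-1` A) = P2 (Z2 @^-1` A)) ->
  measurable_fun setT g -> (forall r, `|g r| <= M) ->
  EE P1 (fun w => g (Z1 w)) = EE P2 (fun w => g (Z2 w)).
Proof.
move=> m1 m2 P12 mg gM.
have mg' : measurable_fun setT (EFin \o g) by apply/measurable_EFinP.
have h1 : P1.-integrable (Z1 @^-1` setT) ((EFin \o g) \o Z1).
  rewrite preimage_setT; apply: (@L1_bounded _ _ _ _ _ M) => //.
  exact: measurableT_comp.
have h2 : P2.-integrable (Z2 @^-1` setT) ((EFin \o g) \o Z2).
  rewrite preimage_setT; apply: (@L1_bounded _ _ _ _ _ M) => //.
  exact: measurableT_comp.
have e1 := integral_pushforward m1 mg' h1 measurableT.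
have e2 := integral_pushforward m2 mg' h2 measurableT.
rewrite !preimage_setT in e1 e2.
rewrite /EE /Rintegral; congr fine.
transitivity (\int[pushforward P1 Z1]_y ((EFin \o g) y))%E; first by rewrite e1.
transitivity (\int[pushforward P2 Z2]_y ((EFin \o g) y))%E; last by rewrite e2.
pose M1 := {| MeasurableFun.sort := Z1;
   MeasurableFun.class := MeasurableFun.Class (isMeasurableFun.Build _ _ _ _ _ m1) |}.
pose M2 := {| MeasurableFun.sort := Z2;
   MeasurableFun.class := MeasurableFun.Class (isMeasurableFun.Build _ _ _ _ _ m2) |}.
apply: (@eq_measure_integral _ _ _ _ (distribution P2 M2) (distribution P1 M1)).
by move=> A mA _; exact: P12.
Qed.

Lemma EE_indic {d} {T : measurableType d} (P : probability T R) (b : T -> bool) :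
  measurable [set w | b w] -> (EE P (fun w => (b w)%:R))%:E = P [set w | b w].
Proof.
move=> mb; rewrite -EFin_EE.
  transitivity (\int[P]_(w in setT) (\1_[set w | b w] w)%:E)%E.
    by apply: eq_integral => w _; rewrite indicE mem_setE.
  by rewrite integral_indic// setIT.
apply: (@L1_bounded _ _ _ _ _ 1).
  rewrite (_ : (fun _ => _) = \1_[set w | b w]); first exact: measurable_indic.
  by apply/funext => w; rewrite indicE mem_setE.
by move=> w; case: (b w); rewrite ?normr1 ?normr0.
Qed.

(** The open upper rays generate the Borel sets and are closed under intersection, and their
    probabilities are one minus the distribution function; equal distribution functions therefore
    give equal laws. *)
Lemma eq_cdf_EE (Z1 : T1 -> R) (Z2 : T2 -> R) (g : R -> R) (M : R) :
  measurable_fun setT Z1 -> measurable_fun setT Z2 ->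
  (forall c : R, EE P1 (fun w => (Z1 w <= c)%R%:R) = EE P2 (fun w => (Z2 w <= c)%R%:R)) ->
  measurable_fun setT g -> (forall r, `|g r| <= M) ->
  EE P1 (fun w => g (Z1 w)) = EE P2 (fun w => g (Z2 w)).
Proof.
move=> m1 m2 cdf; apply: eq_preimage_EE => // A mA.
pose M1 := {| MeasurableFun.sort := Z1;
   MeasurableFun.class := MeasurableFun.Class (isMeasurableFun.Build _ _ _ _ _ m1) |}.
pose M2 := {| MeasurableFun.sort := Z2;
   MeasurableFun.class := MeasurableFun.Class (isMeasurableFun.Build _ _ _ _ _ m2) |}.
apply: (@measure_unique _ _ _ (@RGenOInfty.G R) (fun n => `]- n%:R, +oo[%classic)
  _ _ _ _ (distribution P1 M1) (distribution P2 M2)) => //.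
- exact: RGenOInfty.measurableE.
- move=> _ _ [x ->] [y ->]; exists (Num.max x y).
  by apply/seteqP; split => z /=; rewrite !in_itv/= !andbT gt_max => /andP.
- by move=> n; exists (- n%:R).
- apply/seteqP; split => // x _; exists (Num.truncn `|x|).+1 => //=.
  by rewrite in_itv/= andbT ltrNl (le_lt_trans (ler_norm _))// normrN truncnS_gt.
- move=> _ [c ->]; rewrite /distribution /pushforward/=.
  have mle d (T : measurableType d) (Z : T -> R) : measurable_fun setT Z ->
      measurable [set w | Z w <= c].
    move=> mZ; rewrite (_ : [set w | _] = setT `&` Z @^-1` `]-oo, c]).
      by apply: mZ => //; exact: measurable_itv.
    by apply/seteqP; split => w /=; rewrite in_itv/= => // -[].
  have E d (T : measurableType d) (P : probability T R) (Z : T -> R) :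
      measurable_fun setT Z ->
      P (Z @^-1` `]c, +oo[) = (1 - (EE P (fun w => (Z w <= c)%R%:R))%:E)%E.
    move=> mZ; rewrite EE_indic; last exact: mle.
    rewrite -probability_setC; last exact: mle.
    congr (P _); apply/seteqP; split => w /=; rewrite in_itv/= andbT ltNge.
      by move/negP.
    by move=> h; apply/negP.
  by apply: etrans (E _ _ P1 _ m1) _; rewrite cdf; exact: esym (E _ _ P2 _ m2).
- by move=> n; rewrite (le_lt_trans (probability_le1 _ _))// ?ltry//; exact: measurable_itv.
Qed.

End equality_in_law.

(** * Polynomial approximation of the sign function *)

Section sign_iteration.
Context {R : realType}.
Implicit Types u : R.

(** The Newton-Schulz iteration for the sign. Being a polynomial, it can be applied inside an
    algebra of functionals, while its iterates have a discontinuous limit. *)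
Definition sgstep u := (3 * u - u ^+ 3) / 2.

Lemma sgstep_itv u : 0 <= u <= 1 -> u <= sgstep u <= 1.
Proof.
move=> /andP[u0 u1]; have u1' : 0 <= 1 - u by rewrite subr_ge0.
apply/andP; split; rewrite -subr_ge0 /sgstep.
  rewrite (_ : _ - _ = u * (1 - u) * (1 + u) / 2); last by field.
  by rewrite !mulr_ge0// addr_ge0.
rewrite (_ : _ - _ = (1 - u) ^+ 2 * (2 + u) / 2); last by field.
by rewrite !mulr_ge0 ?exprn_ge0// addr_ge0.
Qed.

Lemma sgstepN u : sgstep (- u) = - sgstep u.
Proof. by rewrite /sgstep; field. Qed.

Lemma iter_sgstepN n u : iter n sgstep (- u) = - iter n sgstep u.
Proof. by elim: n => //= n ->; rewrite sgstepN. Qed.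

Lemma iter_sgstep_itv n u : 0 <= u <= 1 -> 0 <= iter n sgstep u <= 1.
Proof.
move=> u01; elim: n => //= n IH.
have /andP[h ->] := sgstep_itv IH; rewrite andbT (le_trans _ h)//.
by case/andP: IH.
Qed.

Lemma iter_sgstep_le1 n u : `|u| <= 1 -> `|iter n sgstep u| <= 1.
Proof.
have pos v : 0 <= v -> v <= 1 -> `|iter n sgstep v| <= 1.
  move=> v0 v1; have /(iter_sgstep_itv n)/andP[h0 h1] : 0 <= v <= 1 by rewrite v0.
  by rewrite ger0_norm.
have [u0|u0] := leP 0 u; first by rewrite ger0_norm//; exact: pos.
rewrite ltr0_norm// => u1; rewrite -[u]opprK iter_sgstepN normrN.
by apply: pos => //; rewrite oppr_ge0 ltW.
Qed.

(* [sgstep] increases on [0, 1] and its only positive fixed point is 1. *)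
Lemma iter_sgstep_cvg u : `|u| <= 1 -> iter n sgstep u @[n --> \oo] --> Num.sg u.
Proof.
have pos v : 0 < v -> v <= 1 -> iter n sgstep v @[n --> \oo] --> (1 : R).
  move=> v0 v1; have v01 : 0 <= v <= 1 by rewrite ltW.
  have nd : nondecreasing_seq (fun n => iter n sgstep v).
    apply/nondecreasing_seqP => n /=.
    by have /andP[] := sgstep_itv (iter_sgstep_itv n v01).
  have cv : cvgn (fun n => iter n sgstep v).
    apply: nondecreasing_is_cvgn => //; exists 1 => _ [n _ <-].
    by have /andP[] := iter_sgstep_itv n v01.
  set l := limn (fun n => iter n sgstep v) in cv *.
  have vl : v <= l by exact: (nondecreasing_cvgn_le nd cv 0%N).
  have ll : sgstep l = l.
    have h1 : iter n.+1 sgstep v @[n --> \oo] --> l.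
      by rewrite (cvg_shiftS (fun n => iter n sgstep v)).
    have h2 : iter n.+1 sgstep v @[n --> \oo] --> sgstep l.
      apply: cvgMr_tmp; apply: cvgB; first exact: cvgMl_tmp.
      rewrite /= (_ : (fun _ => _) = (fun n =>
        iter n sgstep v * (iter n sgstep v * iter n sgstep v))); last first.
        by apply/funext => n; rewrite exprS expr2.
      by rewrite exprS expr2; apply: cvgM => //; apply: cvgM.
    exact: cvg_unique h2 h1.
  suff <- : l = 1 by exact: cv.
  move: ll; rewrite /sgstep => ll.
  have : l * ((1 - l) * (1 + l)) = 0 by nra.
  move/eqP; rewrite !mulf_eq0 => /or3P[] /eqP h; lra.
move=> u1; have [u0|u0|->] := ltgtP u 0.
- rewrite ltr0_sg// (_ : (fun n => _) = (fun n => - iter n sgstep (- u))).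
    by apply: cvgN; apply: pos; [rewrite oppr_gt0|rewrite -(ltr0_norm u0)].
  by apply/funext => n; rewrite iter_sgstepN opprK.
- by rewrite gtr0_sg//; apply: pos; rewrite // -(gtr0_norm u0).
- rewrite sgr0; apply: cvg_near_cst; apply: nearW => n.
  by elim: n => //= n ->; rewrite /sgstep; field.
Qed.

End sign_iteration.

(** * An algebra of functionals generated by cosines of linear forms *)

Section trigonometric_functionals.
Context {R : realType}.
Implicit Types (L F G : (nat -> R) -> R) (x : nat -> R).

Definition linform L := exists n (c : nat -> R),
  forall x, L x = \sum_(i < n) c i * x i.

(* Functionals whose expectation is determined by the characteristic functions of
   the linear combinations of the coordinates. *)
Inductive trig : ((nat -> R) -> R) -> Prop :=
| trig_cos L : linform L -> trig (fun x => cos (L x))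
| trig_add F G : trig F -> trig G -> trig (fun x => F x + G x)
| trig_scale a F : trig F -> trig (fun x => a * F x)
| trig_lim (F_ : nat -> (nat -> R) -> R) F M : (forall n, trig (F_ n)) ->
    (forall n x, `|F_ n x| <= M) ->
    (forall x, F_ n x @[n --> \oo] --> F x) -> trig F.

Lemma linform_pad L : linform L -> exists n (c : nat -> R), forall m, (n <= m)%N ->
  forall x, L x = \sum_(i < m) c i * x i.
Proof.
move=> [n [c Lc]]; exists n, (fun i => if (i < n)%N then c i else 0) => m nm x.
rewrite Lc (big_ord_widen _ (fun i => c i * x i) nm) big_mkcond/=.
by apply: eq_bigr => i _; case: ifP => // _; rewrite mul0r.
Qed.

Lemma linformD L L' : linform L -> linform L' -> linform (fun x => L x + L' x).
Proof.
move=> /linform_pad[n [c Lc]] /linform_pad[m [c' Lc']].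
exists (maxn n m), (fun i => c i + c' i) => x.
rewrite (Lc (maxn n m) (leq_maxl _ _)) (Lc' (maxn n m) (leq_maxr _ _)) -big_split/=.
by apply: eq_bigr => i _; rewrite mulrDl.
Qed.

Lemma linformZ a L : linform L -> linform (fun x => a * L x).
Proof.
move=> [n [c Lc]]; exists n, (fun i => a * c i) => x.
by rewrite Lc mulr_sumr; apply: eq_bigr => i _; rewrite mulrA.
Qed.

Lemma linformB L L' : linform L -> linform L' -> linform (fun x => L x - L' x).
Proof.
move=> hL /(linformZ (-1))/(linformD hL).
by under eq_fun do rewrite mulN1r.
Qed.

Lemma linform_proj i : linform (fun x => x i).
Proof.
exists i.+1, (fun j => (j == i)%:R) => x.
rewrite big_ord_recr/= eqxx mul1r big1 ?add0r// => j _.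
by rewrite ltn_eqF ?mul0r.
Qed.

Lemma trig_bounded F : trig F -> exists M, forall x, `|F x| <= M.
Proof.
elim=> [L _|{}F G _ [M FM] _ [N GN]|a {}F _ [M FM]|F_ {}F M _ _ FM cF].
- by exists 1 => x; exact: cos_max.
- by exists (M + N) => x; rewrite (le_trans (ler_normD _ _))// lerD.
- by exists (`|a| * M) => x; rewrite normrM ler_wpM2l.
- exists M => x; rewrite -(cvg_lim _ (cvg_norm (cF x)))//; apply: limr_le.
    by apply/cvg_ex; eexists; apply: cvg_norm; apply: cF.
  exact: nearW.
Qed.

Lemma trig_cst a : trig (fun=> a).
Proof.
rewrite (_ : (fun=> a) = fun x : nat -> R => a * cos ((fun=> 0) x)); last first.
  by apply/funext => x; rewrite cos0 mulr1.
apply: trig_scale; apply: (@trig_cos (fun=> 0)).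
by exists 0%N, (fun=> 0) => x; rewrite big_ord0.
Qed.

(** The product-to-sum formula handles two cosines; the other cases follow by induction on each
    factor in turn, a bounded limit surviving multiplication because members of [trig] are
    bounded. *)
Lemma trigM F G : trig F -> trig G -> trig (fun x => F x * G x).
Proof.
have cosM L G' : linform L -> trig G' -> trig (fun x => cos (L x) * G' x).
  move=> hL; elim=> [L' hL'|F1 G1 _ h1 _ h2|a F1 _ h1|F_ F1 M _ h FM cF].
  - rewrite (_ : (fun _ => _) =
      (fun x => 2^-1 * (cos (L x + L' x) + cos (L x - L' x)))).
      apply: trig_scale; apply: trig_add.
        exact: (@trig_cos (fun x => L x + L' x) (linformD hL hL')).
      exact: (@trig_cos (fun x => L x - L' x) (linformB hL hL')).
    by apply/funext => x; rewrite cosD cosB; field.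
  - by under eq_fun do rewrite mulrDr; apply: trig_add.
  - by under eq_fun do rewrite mulrCA; apply: trig_scale.
  - apply: (@trig_lim _ _ M h) => [n x|x].
      by rewrite normrM (le_trans _ (FM n x))// ler_piMl// cos_max.
    exact: cvgMl_tmp.
elim=> [L hL|F1 G1 _ h1 _ h2 hG|a F1 _ h1 hG|F_ F1 M _ h FM cF hG].
- exact: cosM.
- by under eq_fun do rewrite mulrDl; apply: trig_add; [apply: h1|apply: h2].
- by under eq_fun do rewrite -mulrA; apply: trig_scale; apply: h1.
- have [N GN] := trig_bounded hG.
  apply: (@trig_lim (fun n x => F_ n x * G x) _ (M * N)) => [n|n x|x].
  + exact: h.
  + by rewrite normrM ler_pM.
  + exact: cvgMr_tmp.
Qed.

Lemma trig_sg F : trig F -> (forall x, `|F x| <= 1) -> trig (fun x => Num.sg (F x)).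
Proof.
move=> tF F1; apply: (@trig_lim (fun n x => iter n sgstep (F x)) _ 1) => [n|n x|x].
- elim: n => [//|n IH].
  rewrite (_ : (fun _ => _) = (fun x => 3 / 2 * iter n sgstep (F x) +
      - 2^-1 * (iter n sgstep (F x) * (iter n sgstep (F x) * iter n sgstep (F x))))).
    by apply: trig_add; apply: trig_scale => //; do 2 apply: trigM => //.
  by apply/funext => x /=; rewrite /sgstep; field.
- exact: iter_sgstep_le1.
- exact: iter_sgstep_cvg.
Qed.

Lemma trig_gt0 F : trig F -> (forall x, `|F x| <= 1) ->
  trig (fun x => (0 < F x)%R%:R).
Proof.
move=> tF F1; have ts := trig_sg tF F1.
(* For a sign s in {-1, 0, 1}, the number (s + s^2) / 2 is 1 at s = 1 and 0 otherwise. *)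
rewrite (_ : (fun _ => _) =
  (fun x => 2^-1 * (Num.sg (F x) + Num.sg (F x) * Num.sg (F x)))).
  by apply: trig_scale; apply: trig_add => //; apply: trigM.
apply/funext => x; case: (ltgtP (F x) 0) => [h|h|->].
- by rewrite ltr0_sg//= mulr0n; field.
- by rewrite gtr0_sg//= mulr1n; field.
- by rewrite sgr0/= mulr0n; field.
Qed.

Lemma trig_prod_bool (b : nat -> (nat -> R) -> bool) n :
  (forall i, trig (fun x => (b i x)%:R)) ->
  trig (fun x => \prod_(i < n) (b i x)%:R).
Proof.
move=> tb; elim: n => [|n IH].
  by under eq_fun do rewrite big_ord0; exact: trig_cst.
by under eq_fun do rewrite big_ord_recr/=; apply: trigM.
Qed.

Lemma prod_boolE (b : nat -> bool) n :
  \prod_(i < n) (b i)%:R = [forall i : 'I_n, b i]%:R :> R.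
Proof.
elim: n b => [|n IH] b.
  by rewrite big_ord0; have -> : [forall i : 'I_0, b i] by apply/forallP => -[].
rewrite big_ord_recr/= IH; case: (forallP (P := fun i : 'I_n => b i)) => H.
  rewrite mul1r; congr (nat_of_bool _)%:R; apply/idP/forallP => [bn i|]; last first.
    by move/(_ ord_max).
  have := ltn_ord i; rewrite ltnS leq_eqVlt => /predU1P[->//|h].
  exact: (H (Ordinal h)).
rewrite mul0r; case: forallP => // h; exfalso; apply: H => i.
exact: (h (widen_ord (leqnSn n) i)).
Qed.

(** Finite conjunctions are products of indicators, and at each point these products are eventually
    constant in [n]: this gives countable intersections of events. *)
Lemma trig_forall (b : nat -> (nat -> R) -> bool) (c : (nat -> R) -> bool) :
  (forall i, trig (fun x => (b i x)%:R)) ->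
  (forall x, reflect (forall i, b i x) (c x)) ->
  trig (fun x => (c x)%:R).
Proof.
move=> tb bc; apply: (@trig_lim (fun n x => \prod_(i < n) (b i x)%:R) _ 1).
- by move=> n; apply: trig_prod_bool.
- by move=> n x; rewrite (prod_boolE (b^~ x)); case: [forall i, _]; rewrite ?normr1 ?normr0.
- move=> x; case: bc => h.
    by apply: cvg_near_cst; apply: nearW => n; rewrite big1// => i _; rewrite h.
  have [i bi] : exists i, ~~ b i x.
    by apply: contrapT => h'; apply: h => i; apply: contrapT => /negP h2; apply: h'; exists i.
  apply: cvg_near_cst; exists i.+1 => // n /= ni.
  by rewrite (bigD1 (Ordinal ni))//= (negbTE bi) mul0r.
Qed.

(* For [c 2^j <= |y| < c 2^(j+1)] the angle [pi y / (2 c 2^j)] lies in [pi/2, pi[. *)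
Lemma norm_lt_cosP (c y : R) : 0 < c ->
  reflect (forall j : nat, 0 < cos (pi / (2 * c * 2 ^+ j) * y)) (`|y| < c).
Proof.
move=> c0; have pi0 : 0 < pi :> R := pi_gt0 R.
have p2 j : 0 < (2 : R) ^+ j by rewrite exprn_gt0.
have D0 j : 0 < 2 * c * 2 ^+ j by rewrite !mulr_gt0.
have E j : cos (pi / (2 * c * 2 ^+ j) * y) = cos (`|y| / (c * 2 ^+ j) * (pi / 2)).
  rewrite -[LHS]cos_norm normrM ger0_norm ?divr_ge0 ?(ltW pi0) ?ltW//.
  by congr cos; field; rewrite !gt_eqF.
apply: (iffP idP) => [yc j|h].
  rewrite E; apply: cos_gt0_pihalf; apply/andP; split.
    rewrite (@lt_le_trans _ _ 0)// ?oppr_lt0 ?divr_gt0//.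
    by rewrite mulr_ge0// divr_ge0// ltW// mulr_gt0.
  rewrite gtr_pMl ?divr_gt0// ltr_pdivrMr ?mulr_gt0// mul1r (lt_le_trans yc)//.
  by rewrite ler_pMr//; apply: exprn_ege1; rewrite ler1n.
rewrite ltNge; apply/negP => cy.
have [j [j1 j2]] : exists j, c * 2 ^+ j <= `|y| /\ `|y| < c * 2 ^+ j.+1.
  pose p j := `|y| < c * 2 ^+ j.
  have exp : exists j, p j.
    exists (Num.truncn (`|y| / c)).+1; rewrite /p mulrC -ltr_pdivrMr//.
    apply: lt_le_trans (truncnS_gt _) _; rewrite -natrX ler_nat ltnW//.
    exact: ltn_expl.
  case: (ex_minnP exp) => -[|m] pm min.
    by move: pm; rewrite /p expr0 mulr1 ltNge cy.
  exists m; split => //; rewrite leNgt; apply/negP => /min.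
  by rewrite ltnn.
have := h j; rewrite E; apply/negP; rewrite -leNgt.
set t := _ * (pi / 2).
have t1 : pi / 2 <= t.
  by rewrite /t ler_pMl ?divr_gt0// ler_pdivlMr ?mulr_gt0// mul1r.
have t2 : t < pi.
  rewrite /t mulrA ltr_pdivrMr// [pi * 2]mulrC ltr_pM2r// ltr_pdivrMr ?mulr_gt0//.
  by rewrite mulrCA -exprS.
rewrite -[t](subrK (pi / 2)) cosDpihalf oppr_le0; apply: sin_ge0_pi.
by rewrite subr_ge0 t1 lerBlDr (le_trans (ltW t2))// lerDl divr_ge0// ltW.
Qed.

Lemma trig_norm_lt L (c : R) : linform L -> 0 < c ->
  trig (fun x => (`|L x| < c)%R%:R).
Proof.
move=> hL c0; apply: (@trig_forall
  (fun j x => 0 < cos (pi / (2 * c * 2 ^+ j) * L x))) => [j|x].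
  apply: trig_gt0 => [|x]; last exact: cos_max.
  exact: (@trig_cos (fun x => _ * L x) (linformZ _ hL)).
exact: norm_lt_cosP.
Qed.

(** The closed event is the intersection of the open ones at levels c + 1/(m+1); this also reaches c
    = 0, where the cosine criterion does not apply. *)
Lemma trig_norm_le L (c : R) : linform L -> 0 <= c ->
  trig (fun x => (`|L x| <= c)%R%:R).
Proof.
move=> hL c0; apply: (@trig_forall (fun m x => `|L x| < c + m.+1%:R^-1)) => [m|x].
  by apply: trig_norm_lt => //; rewrite ltr_wpDl// invr_gt0.
apply: (iffP idP) => [h m|h]; first by rewrite (le_lt_trans h)// ltrDl invr_gt0.
apply/ler_addgt0Pl => e e0; rewrite addrC; apply: ltW.
pose m := Num.truncn e^-1; apply: lt_le_trans (h m) _; rewrite lerD2l.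
rewrite -[leRHS]invrK lef_pV2 ?posrE ?invr_gt0//.
exact: ltW (truncnS_gt _).
Qed.

End trigonometric_functionals.

(** * From characteristic functions to the law of a supremum *)

Section cramer_wold.
Context {R : realType} {d1 d2 : measure_display}.
Context {T1 : measurableType d1} {T2 : measurableType d2}.
Variables (P1 : probability T1 R) (P2 : probability T2 R).
Variables (U : nat -> T1 -> R) (V : nat -> T2 -> R).
Hypothesis mU : forall i, measurable_fun setT (U i).
Hypothesis mV : forall i, measurable_fun setT (V i).
Hypothesis cosUV : forall L, linform L ->
  EE P1 (fun w => cos (L (U^~ w))) = EE P2 (fun w => cos (L (V^~ w))).

Lemma measurable_linform {d} {T : measurableType d} (X : nat -> T -> R) L :
  (forall i, measurable_fun setT (X i)) -> linform L ->
  measurable_fun setT (fun w => L (X^~ w)).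
Proof.
move=> mX [n [c Lc]]; under eq_fun do rewrite Lc.
by apply: measurable_sum => i; apply: measurable_funM.
Qed.

Lemma measurable_trig {d} {T : measurableType d} (X : nat -> T -> R) F :
  (forall i, measurable_fun setT (X i)) -> trig F ->
  measurable_fun setT (fun w => F (X^~ w)).
Proof.
move=> mX; elim=> [L hL|F1 G1 _ h1 _ h2|a F1 _ h1|F_ F1 M _ h _ cF].
- apply: (measurableT_comp (f := cos)); last exact: measurable_linform.
  by apply: continuous_measurable_fun; exact: continuous_cos.
- exact: measurable_funD.
- exact: measurable_funM.
- by apply: (measurable_fun_cvg h) => w _; exact: cF.
Qed.

(** Each constructor of [trig] preserves equality of expectations: linearity for sums and multiples,
    bounded convergence for limits. *)
Lemma trig_EE F : trig F -> EE P1 (fun w => F (U^~ w)) = EE P2 (fun w => F (V^~ w)).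
Proof.
have L1t d (T : measurableType d) (P : probability T R) X G :
    (forall i, measurable_fun setT (X i)) -> trig G -> L1 P (fun w => G (X^~ w)).
  move=> mX tG; have [M GM] := trig_bounded tG.
  by apply: (@L1_bounded _ _ _ _ _ M) => // ; exact: measurable_trig.
elim=> [L hL|F1 G1 t1 h1 t2 h2|a F1 t1 h1|F_ F1 M tF h FM cF].
- exact: cosUV.
- by rewrite !EED ?h1 ?h2//; exact: L1t.
- by rewrite !EEZ ?h1//; exact: L1t.
- have c1 : EE P1 (fun w => F_ n (U^~ w)) @[n --> \oo] --> EE P1 (fun w => F1 (U^~ w)).
    by apply: EE_bounded_cvg => [n|n w|w] => //; exact: measurable_trig.
  have c2 : EE P2 (fun w => F_ n (V^~ w)) @[n --> \oo] --> EE P2 (fun w => F1 (V^~ w)).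
    by apply: EE_bounded_cvg => [n|n w|w] => //; exact: measurable_trig.
  by rewrite -(funext h) in c2; exact: cvg_unique c1 c2.
Qed.

(** For c >= 0 the distribution function is the expectation of the indicator of all the events
    [|x i| <= c] together, which lies in [trig]; for c < 0 it vanishes because both variables are
    nonnegative. *)
Lemma eq_law_norm_sup (Z1 : T1 -> R) (Z2 : T2 -> R) (g : R -> R) (M : R) :
  measurable_fun setT Z1 -> measurable_fun setT Z2 ->
  (forall w, 0 <= Z1 w) -> (forall w, 0 <= Z2 w) ->
  (forall w c, Z1 w <= c <-> forall i, `|U i w| <= c) ->
  (forall w c, Z2 w <= c <-> forall i, `|V i w| <= c) ->
  measurable_fun setT g -> (forall r, `|g r| <= M) ->
  EE P1 (fun w => g (Z1 w)) = EE P2 (fun w => g (Z2 w)).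
Proof.
move=> m1 m2 Z10 Z20 H1 H2 mg gM; apply: eq_cdf_EE => // c.
have [c0|c0] := leP 0 c; last first.
  transitivity (0 : R).
    rewrite -[RHS](EE_cst P1); apply: eq_EE => w.
    by rewrite leNgt (lt_le_trans c0).
  rewrite -[LHS](EE_cst P2); apply: eq_EE => w.
  by rewrite leNgt (lt_le_trans c0).
pose F (x : nat -> R) : R := `[< forall i : nat, `|x i| <= c >]%:R.
have tF : trig F.
  apply: (@trig_forall _ (fun i x => `|x i| <= c)) => [i|x]; last exact: asboolP.
  by apply: trig_norm_le => //; exact: linform_proj.
transitivity (EE P1 (fun w => F (U^~ w))).
  by apply: eq_EE => w; congr (nat_of_bool _)%:R; apply/idP/asboolP; apply H1.
rewrite trig_EE//; apply: eq_EE => w; congr (nat_of_bool _)%:R.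
by apply/asboolP/idP; apply H2.
Qed.

End cramer_wold.

(** * Second moment of the standard normal law *)

Section normal_second_moment.
Context {R : realType}.
Notation leb := (@lebesgue_measure R).
Notation phi := (normal_pdf (0 : R) 1).

Lemma std_normal_pdfE : phi = fun x => normal_peak 1 * expR (- (x ^+ 2) / 2).
Proof.
rewrite normal_pdfE ?oner_neq0//; apply/funext => x.
by rewrite /normal_fun subr0 expr1n.
Qed.

Lemma is_derive_std_normal_pdf (x : R) : is_derive x 1 phi (- (x * phi x)).
Proof.
rewrite std_normal_pdfE.
have h : is_derive x 1 (fun y : R => - (y ^+ 2) / 2) (- x).
  rewrite (_ : (fun y => _) = (- 2^-1) *: ((@id R) ^+ 2)); last first.
    apply/funext => y; rewrite exprfctE.
    by rewrite -[RHS]/(- 2^-1 * y ^+ 2); field.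
  have := is_deriveZ (- 2^-1) (is_deriveX 2 (is_derive_id x 1)).
  by rewrite /GRing.scale/= expr1 (_ : - 2^-1 * _ = - x)//; field.
have h2 := @is_derive1_comp R expR (fun y : R => - (y ^+ 2) / 2) x _ _
  (is_derive_expR _) h.
have h3 : is_derive x 1 (normal_peak 1 *: (expR \o (fun y : R => - (y ^+ 2) / 2)))
    (normal_peak 1 *: (expR (- (x ^+ 2) / 2) * - x)).
  exact: is_deriveZ.
have -> : - (x * (normal_peak 1 * expR (- (x ^+ 2) / 2))) =
    normal_peak 1 *: (expR (- (x ^+ 2) / 2) * - x).
  by rewrite /GRing.scale/=; ring.
exact: h3.
Qed.

Let cphi : continuous phi. Proof. by apply: continuous_normal_pdf; exact: oner_neq0. Qed.

Let phi0 x : 0 <= phi x. Proof. exact: normal_pdf_ge0. Qed.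

Let cxphi : continuous (fun x : R => x * phi x).
Proof. by move=> x; apply: cvgM; [exact: cvg_id|exact: cphi]. Qed.

Let cx2phi : continuous (fun x : R => x * (x * phi x)).
Proof. by move=> x; apply: cvgM; [exact: cvg_id|exact: cxphi]. Qed.

(** The function [x * phi x] is the derivative of [- phi], so it is the factor to integrate. The
    bound [n.+1] keeps the interval nondegenerate. *)
Lemma std_normal_by_parts n :
  (\int[leb]_(x in `[0%R, n.+1%:R]) (x * (x * phi x))%:E =
   (- (n.+1%:R * phi n.+1%:R))%:E + \int[leb]_(x in `[0%R, n.+1%:R]) (phi x)%:E)%E.
Proof.
have n0 : 0 < n.+1%:R :> R by [].
have dphi (x : R) : is_derive x 1 (fun y : R => - phi y) (x * phi x).
  have h := is_derive_std_normal_pdf x.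
  by rewrite -[X in is_derive _ _ _ X]opprK; exact: is_deriveN.
rewrite (@integration_by_parts _ id (fun x => - phi x) (cst 1) (fun x => x * phi x))//=.
- rewrite mul0r subr0 mulrN; congr (_ + _)%E.
  transitivity (- \int[leb]_(x in `[0%R, n.+1%:R]) - (phi x)%:E)%E.
    by congr (- _)%E; apply: eq_integral => x _; rewrite mul1r EFinN.
  by rewrite integral_ge0N ?oppeK// => x _; rewrite lee_fin.
- by apply: continuous_subspaceT => x; exact: cvg_cst.
- split; first by move=> x _; exact: derivable_id.
  + by apply: cvg_at_right_filter; exact: cvg_id.
  + by apply: cvg_at_left_filter; exact: cvg_id.
- by move=> x _; rewrite derive1E derive_id.
- exact: continuous_subspaceT.
- split; first by move=> x _; have [] := dphi x.
  + by apply: cvg_at_right_filter; apply: cvgN; exact: cphi.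
  + by apply: cvg_at_left_filter; apply: cvgN; exact: cphi.
- by move=> x _; rewrite derive1E; have [_ ->] := dphi x.
Qed.

Lemma std_normal_tail : n.+1%:R * phi n.+1%:R @[n --> \oo] --> 0.
Proof.
have pk : 0 <= normal_peak 1 :> R by exact: normal_peak_ge0.
apply: (@squeeze_cvgr _ _ _ _ (fun=> 0) (fun n => 2 * normal_peak 1 * n.+1%:R^-1)).
- apply: nearW => n; rewrite mulr_ge0//=.
  rewrite std_normal_pdfE mulrCA.
  rewrite [leRHS](_ : _ = normal_peak 1 * (2 * n.+1%:R^-1)); last first.
    by rewrite mulrA [2 * _]mulrC.
  rewrite ler_wpM2l//.
  set m : R := n.+1%:R; have m0 : 0 < m by rewrite ltr0n.
  rewrite mulNr expRN ler_pdivrMr ?expR_gt0//.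
  (* The bound exp(m^2/2) >= 1 + m^2/2 suffices, since (2/m)(1 + m^2/2) = 2/m + m. *)
  apply: (@le_trans _ _ (2 * m^-1 * (1 + m ^+ 2 / 2))).
    rewrite (_ : 2 * _ * _ = m + 2 * m^-1); last by field; rewrite gt_eqF.
    by rewrite lerDl mulr_ge0// invr_ge0 ltW.
  by rewrite ler_wpM2l ?expR_ge1Dx// mulr_ge0// invr_ge0 ltW.
- exact: cvg_cst.
- rewrite -[X in _ --> X](mulr0 (2 * normal_peak 1)).
  by apply: cvgMl_tmp; exact: cvg_harmonic.
Qed.

(** By symmetry the second moment and the total mass are twice their halves on the positive axis,
    and on [0, n+1] these halves differ by a boundary term that vanishes; hence the second moment
    equals the mass. *)
Lemma std_normal_second_moment : (\int[leb]_x (x * (x * phi x))%:E = 1)%E.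
Proof.
have x2phi0 x : 0 <= x * (x * phi x) by rewrite mulrA mulr_ge0// -expr2 sqr_ge0.
have even x : phi (- x) = phi x by rewrite !std_normal_pdfE sqrrN.
have c1 := @ge0_cvgn_integral R leb _ x2phi0 (continuous_measurable_fun cx2phi).
have c2 := @ge0_cvgn_integral R leb _ phi0 (continuous_measurable_fun cphi).
rewrite -cvg_shiftS in c1; rewrite -cvg_shiftS in c2.
rewrite (funext std_normal_by_parts) in c1.
rewrite ge0_symfun_integralT//; last first.
  by move=> x /=; rewrite even; ring.
rewrite -(integral_normal_pdf (0 : R) 1).
rewrite [RHS]ge0_symfun_integralT//; last by move=> x /=; rewrite even.
congr (_ * _)%E; rewrite -set_itvcy.
have c3 : ((- (n.+1%:R * phi n.+1%:R))%:E + \int[leb]_(x in `[0%R, n.+1%:R]) (phi x)%:E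
   @[n --> \oo] --> (- 0)%:E + \int[leb]_(x in `[0%R, +oo[) (phi x)%:E)%E.
  apply: cvgeD => //.
  by apply: cvg_EFin; [exact: nearW|apply: cvgN; exact: std_normal_tail].
by rewrite oppr0 add0e in c3; exact: cvg_unique c1 c3.
Qed.

Lemma normal_EE {d} {T : measurableType d} (P : probability T R) (Z : T -> R)
    (g : R -> R) (M : R) :
  measurable_fun setT Z -> is_normal P Z 0 1 ->
  measurable_fun setT g -> (forall r, `|g r| <= M) ->
  (EE P (fun w => g (Z w)))%:E = (\int[leb]_x (g x * phi x)%:E)%E.
Proof.
move=> mZ nZ mg gM.
have mg' : measurable_fun setT (EFin \o g) by apply/measurable_EFinP.
pose N : probability (measurableTypeR R) R := normal_prob (0 : R) 1.
have Lg : L1 N g by apply: (@L1_bounded _ _ _ _ _ M).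
transitivity ((EE N g)%:E).
  congr EFin; apply: (@eq_preimage_EE _ _ _ _ _ P N Z id g M) => //.
  move=> A mA; have := nZ _ mA; rewrite oner_eq0 sqrtr1 => ->.
  by [].
have dom := normal_prob_dominates (0 : R) 1.
rewrite -EFin_EE//.
rewrite -(Radon_Nikodym_change_of_variables dom)//=.
apply: ae_eq_integral => //.
- by apply: emeasurable_funM => //; apply: (measurable_int leb).
- have : measurable_fun setT (fun x : R => g x * phi x).
    by apply: measurable_funM => //; exact: measurable_normal_pdf.
  by move=> /measurable_EFinP.
- under [X in ae_eq _ _ _ X]eq_fun do rewrite EFinM.
  apply: ae_eqe_mul2l => /=.
  (* The Radon-Nikodym derivative is an unspecified choice; having the same integrals as the
     density, it agrees with it almost everywhere. *)
  rewrite Radon_NikodymE/=.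
  case: cid => /= h [h1 h2 h3].
  apply: integral_ae_eq => //=.
  + by apply/measurable_EFinP; exact: measurable_normal_pdf.
  + by move=> E _ mE; rewrite -h3.
Qed.

(** Truncation makes the integrand bounded, as weak convergence will require; monotone convergence
    removes it in the limit. *)
Lemma std_normal_trunc_moment {d} {T : measurableType d} (P : probability T R)
    (Z : T -> R) :
  measurable_fun setT Z -> is_normal P Z 0 1 ->
  EE P (fun w => Num.min (Z w ^+ 2) n%:R) @[n --> \oo] --> (1 : R).
Proof.
move=> mZ nZ.
have mm n : measurable_fun setT (fun x : R => Num.min (x ^+ 2) n%:R).
  by apply: measurable_minr => //; exact: measurable_funX.
have m0 n (x : R) : 0 <= Num.min (x ^+ 2) n%:R by rewrite le_min sqr_ge0/=.
have H : (\int[leb]_x (Num.min (x ^+ 2) n%:R * phi x)%:E)%E @[n --> \oo] -->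
    (\int[leb]_x (x * (x * phi x))%:E)%E.
  rewrite (_ : (\int[leb]_x (x * (x * phi x))%:E)%E =
    (\int[leb]_x (limn (fun n : nat => (Num.min (x ^+ 2) n%:R * phi x)%:E)))%E).
    apply: cvg_monotone_convergence => //.
    - move=> n.
      have : measurable_fun setT (fun x : R => Num.min (x ^+ 2) n%:R * phi x).
        by apply: measurable_funM => //; exact: measurable_normal_pdf.
      by move=> /measurable_EFinP.
    - by move=> n x _; rewrite lee_fin mulr_ge0.
    - move=> x _ a b ab; rewrite lee_fin ler_wpM2r// le_min ge_min lexx/=.
      by rewrite ge_min ler_nat ab orbT.
  apply: eq_integral => x _; apply/esym/cvg_lim => //.
  apply: cvg_near_cst; exists (Num.truncn (x ^+ 2)).+1 => // n /= xn.
  rewrite min_l ?expr2 ?mulrA//; apply: ltW; apply: lt_le_trans (truncnS_gt _) _.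
  by rewrite ler_nat.
rewrite std_normal_second_moment in H.
have E n : (EE P (fun w => Num.min (Z w ^+ 2) n%:R))%:E =
    (\int[leb]_x (Num.min (x ^+ 2) n%:R * phi x)%:E)%E.
  apply: (@normal_EE _ _ P Z (fun x => Num.min (x ^+ 2) n%:R) n%:R) => // x.
  by rewrite ger0_norm// ge_min lexx orbT.
by rewrite -(funext E) in H; exact: fine_cvg H.
Qed.

End normal_second_moment.

(** * The pinned Wiener process and the Brownian bridge *)

Section bridge_law.
Context {R : realType}.

Lemma big_square_recr n (F : nat -> nat -> R) :
  \sum_(i < n.+1) \sum_(j < n.+1) F i j =
  \sum_(i < n) \sum_(j < n) F i j + \sum_(i < n) F i n + \sum_(j < n) F n j + F n n.
Proof.
rewrite big_ord_recr/= [in X in _ + X]big_ord_recr/= addrA; congr (_ + _ + _).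
by rewrite -big_split; apply: eq_bigr => i _; rewrite big_ord_recr.
Qed.

(** The Gaussian hypothesis on W concerns combinations of its values, so a combination of pinned
    values is rewritten over one more time point, 1, whose coefficient collects all the pinning
    terms. *)
Lemma pinned_form n (c q x : nat -> R) (x1 : R) :
  \sum_(i < n) c i * (x i - q i * x1) =
  \sum_(i < n.+1) (if (i < n)%N then c i else - \sum_(k < n) c k * q k) *
                  (if (i < n)%N then x i else x1).
Proof.
rewrite big_ord_recr/= ltnn mulNr mulr_suml -sumrB; apply: eq_bigr => i _.
by rewrite ltn_ord mulrBr mulrA.
Qed.

(** Put tau = sum of the c_k q_k. The last row and the last column each contribute -tau^2 and the
    corner tau^2, leaving -tau^2, where tau^2 is the double sum of c_i c_j q_i q_j. *)
Lemma pinned_covariance n (c q : nat -> R) : (forall i, 0 <= q i <= 1) ->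
  let a i := if (i < n)%N then c i else - \sum_(k < n) c k * q k in
  let s i := if (i < n)%N then q i else 1 in
  \sum_(i < n.+1) \sum_(j < n.+1) a i * a j * Num.min (s i) (s j) =
  \sum_(i < n) \sum_(j < n) c i * c j * (Num.min (q i) (q j) - q i * q j).
Proof.
move=> q01 a s; rewrite (big_square_recr _ (fun i j => a i * a j * Num.min (s i) (s j))).
set tau := \sum_(k < n) c k * q k in a *.
have an (i : 'I_n) : a i = c i by rewrite /a ltn_ord.
have sn (i : 'I_n) : s i = q i by rewrite /s ltn_ord.
have ann : a n = - tau by rewrite /a ltnn.
have snn : s n = 1 by rewrite /s ltnn.
have m1 i : Num.min (q i) 1 = q i by rewrite min_l//; case/andP: (q01 i).
have -> : \sum_(i < n) a i * a n * Num.min (s i) (s n) = - tau * tau.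
  rewrite /tau mulr_sumr; apply: eq_bigr => i _.
  by rewrite an sn ann snn m1 mulrAC mulrC.
have -> : \sum_(j < n) a n * a j * Num.min (s n) (s j) = - tau * tau.
  rewrite {2}/tau mulr_sumr; apply: eq_bigr => i _.
  by rewrite an sn ann snn minC m1 mulrA.
rewrite ann snn minxx mulr1.
have -> : \sum_(i < n) \sum_(j < n) c i * c j * (Num.min (q i) (q j) - q i * q j) =
    \sum_(i < n) \sum_(j < n) c i * c j * Num.min (q i) (q j) - tau * tau.
  rewrite {1}/tau mulr_suml -sumrB; apply: eq_bigr => i _.
  rewrite /tau mulr_sumr -sumrB; apply: eq_bigr => j _; ring.
rewrite (_ : - tau * - tau = tau * tau); last by ring.
rewrite mulNr subrK; congr (_ - _).
by apply: eq_bigr => i _; apply: eq_bigr => j _; rewrite !an !sn.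
Qed.

Context {d1 d2 : measure_display} {T1 : measurableType d1} {T2 : measurableType d2}.
Variables (Q1 : probability T1 R) (Q2 : probability T2 R).
Variables (W : R -> T1 -> R) (B : R -> T2 -> R).
Hypothesis HW : wiener_process01 Q1 W.
Hypothesis HB : brownian_bridge01 Q2 B.

Lemma wiener_rcont w : rcont01 (W^~ w).
Proof. by apply: continuous_rcont01; exact: HW.2. Qed.

Lemma wiener_ub w : ub01 (fun t => `|W t w|).
Proof.
apply: continuous_ub01 => x; apply: continuous_comp; first exact: HW.2.
exact: norm_continuous.
Qed.

Lemma wiener_bridge_sup_measurable :
  measurable_fun setT (fun w => sup01 (bridge (W^~ w))).
Proof.
apply: (measurable_sup01 (F := fun t w => bridge (W^~ w) t)) => [t|w|w].
- apply: (measurableT_comp (@normr_measurable R setT)); apply: measurable_funB.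
    exact: HW.1.1.
  by apply: measurable_funM => //; exact: HW.1.1.
- by apply: ub01_bridge; exact: wiener_ub.
- by apply: rcont01_bridge; exact: wiener_rcont.
Qed.

Lemma bridge_ub w : ub01 (fun t => `|B t w|).
Proof.
apply: continuous_ub01 => x; apply: continuous_comp; first exact: HB.2.
exact: norm_continuous.
Qed.

Lemma bridge_rcont w : rcont01 (fun t => `|B t w|).
Proof. by move=> t t01; apply: cvg_norm; apply: continuous_rcont01 t t01; exact: HB.2. Qed.

Lemma bridge_sup_measurable :
  measurable_fun setT (fun w => sup01 (fun t => `|B t w|)).
Proof.
apply: (measurable_sup01 (F := fun t w => `|B t w|)) => [t|w|w].
- by apply: (measurableT_comp (@normr_measurable R setT)); exact: HB.1.1.
- exact: bridge_ub.
- exact: bridge_rcont.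
Qed.

(** At the times [q01], any linear form of the pinned W and the same form of B are centred normal
    with equal variance, hence have equal laws and equal cosine expectations. A zero variance needs
    no separate case: [is_normal] then prescribes the same Dirac mass on both sides. *)
Lemma wiener_bridge_sup_law (g : R -> R) (M : R) :
  measurable_fun setT g -> (forall r, `|g r| <= M) ->
  EE Q1 (fun w => g (sup01 (bridge (W^~ w)))) =
  EE Q2 (fun w => g (sup01 (fun t => `|B t w|))).
Proof.
have qi i : q01 i \in `[0 : R, 1] by rewrite in_itv/= q01_itv.
have i1 : (1 : R) \in `[0, 1] by rewrite in_itv/= lexx ler01.
have i0 : 0 <= (0 : R) <= 1 by rewrite lexx ler01.
pose U i w := W (q01 i) w - q01 i * W 1 w.
pose V i w := B (q01 i) w.
have mU i : measurable_fun setT (U i).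
  apply: measurable_funB; first exact: HW.1.1.
  by apply: measurable_funM => //; exact: HW.1.1.
apply: (@eq_law_norm_sup _ _ _ _ _ Q1 Q2 U V) => //.
- by move=> i; exact: HB.1.1.
- move=> L hL; have [n [c Lc]] := hL.
  apply: (@eq_preimage_EE _ _ _ _ _ Q1 Q2 _ _ cos 1).
  + exact: measurable_linform.
  + by apply: measurable_linform => // i; exact: HB.1.1.
  + move=> A mA.
    pose a (i : nat) := if (i < n)%N then c i else - \sum_(k < n) c k * (q01 k : R).
    pose s (i : nat) : R := if (i < n)%N then q01 i else 1.
    have si i : s i \in `[0, 1] by rewrite /s; case: ifP.
    have /(_ _ mA) := HW.1.2 n.+1 (fun i => a i) (fun i => s i) (fun i => si i).
    rewrite (pinned_covariance n c q01_itv).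
    have <- := HB.1.2 n (fun i => c i) (fun i => q01 i) (fun i => qi i) _ mA.
    rewrite (_ : (fun w : T1 => _) = (fun w => L (U^~ w))); last first.
      apply/funext => w; rewrite Lc.
      rewrite (pinned_form n c q01 (fun i => W (q01 i) w) (W 1 w)).
      by apply: eq_bigr => i _; rewrite /s /a; case: ifP.
    by move=> ->; under [in RHS]eq_fun do rewrite Lc.
  + by apply: continuous_measurable_fun; exact: continuous_cos.
  + exact: cos_max.
- exact: wiener_bridge_sup_measurable.
- exact: bridge_sup_measurable.
- move=> w; have := sup01_ub (ub01_bridge (wiener_ub w)) i0.
  by apply: le_trans; exact: normr_ge0.
- move=> w; have := sup01_ub (bridge_ub w) i0.
  by apply: le_trans; exact: normr_ge0.
- move=> w c; apply: sup01_leP.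
    by apply: ub01_bridge; exact: wiener_ub.
  by apply: rcont01_bridge; exact: wiener_rcont.
- by move=> w c; apply: sup01_leP; [exact: bridge_ub|exact: bridge_rcont].
Qed.

End bridge_law.

(** * Finite sums under summability on symmetric windows *)

Section absolutely_summable.
Context {R : realType}.

Lemma ler_sum_uniq_sub (I : eqType) (s t : seq I) (F : I -> R) :
  uniq s -> uniq t -> {subset s <= t} -> (forall i, 0 <= F i) ->
  \sum_(i <- s) F i <= \sum_(i <- t) F i.
Proof.
move=> us ut st F0.
have st' : perm_eq s [seq i <- t | i \in s].
  apply: uniq_perm; rewrite ?filter_uniq// => i; rewrite mem_filter.
  by case: (boolP (i \in s)) => // /st ->.
rewrite (perm_big _ st') big_filter big_mkcond/=; apply: ler_sum => i _.
by case: ifP.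
Qed.

Definition zrange (N : nat) : seq int := [seq i%:Z - N%:Z | i <- iota 0 (N + N).+1].

Lemma zrange_uniq N : uniq (zrange N).
Proof.
rewrite map_inj_uniq ?iota_uniq// => i j /(congr1 (fun x => x + N%:Z)).
by rewrite !subrK => -[].
Qed.

Lemma mem_zrange (x : int) N : (`|x| <= N)%N -> x \in zrange N.
Proof.
move=> xN; apply/mapP; exists (absz (x + N%:Z)).
  by rewrite mem_iota; lia.
by lia.
Qed.

Lemma zrange_cover (s : seq int) : exists N, {subset s <= zrange N}.
Proof.
exists (\max_(x <- s) `|x|%N) => x xs; apply: mem_zrange.
by rewrite (big_rem x xs)/= leq_maxl.
Qed.

Lemma big_zrange N (F : int -> R) :
  \sum_(x <- zrange N) F x = \sum_(i < (N + N).+1) F (i%:Z - N%:Z).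
Proof.
rewrite big_map -[iota 0 _]/(index_iota 0 (N + N).+1) ?subn0.
by rewrite /index_iota -{1}[(N + N).+1]subn0 -/(index_iota 0 (N + N).+1) big_mkord.
Qed.

(** The hypothesis bounds only sums over windows [-N, N]; any finite set of distinct integers fits
    in one of them, and the terms are nonnegative. *)
Lemma sum_inj_le (I : eqType) (r : seq I) (f : I -> int) (a : int -> R) (M : R) :
  (forall N : nat, \sum_(i < (N + N).+1) `|a (i%:Z - N%:Z)| <= M) ->
  uniq r -> injective f -> \sum_(i <- r) `|a (f i)| <= M.
Proof.
move=> aM ur fi; rewrite -(big_map f xpredT (fun x => `|a x|)).
have [N sN] := zrange_cover (map f r).
apply: le_trans (aM N); rewrite -(big_zrange N (fun x => `|a x|)).
by apply: ler_sum_uniq_sub => //; [rewrite map_inj_uniq|exact: zrange_uniq].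
Qed.

(** Only joint injectivity of [f] is asked, because the variance bound reindexes by (l - i, l + k -
    i), whose second coordinate mixes both indices. *)
Lemma sum_inj2_le (I J : eqType) (r : seq I) (s : seq J) (f : I -> J -> int * int)
    (a : int -> int -> R) (M : R) :
  (forall N : nat, \sum_(i < (N + N).+1) \sum_(j < (N + N).+1)
     `|a (i%:Z - N%:Z) (j%:Z - N%:Z)| <= M) ->
  uniq r -> uniq s -> (forall i j i' j', f i j = f i' j' -> i = i' /\ j = j') ->
  \sum_(i <- r) \sum_(j <- s) `|a (f i j).1 (f i j).2| <= M.
Proof.
move=> aM ur us fi.
rewrite -(big_allpairs_dep (h := f) (r1 := r) (r2 := fun=> s)
  (F := fun x : int * int => `|a x.1 x.2|)).
set l := [seq _ | _ <- r, _ <- s].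
have [N sN] := zrange_cover ([seq x.1 | x <- l] ++ [seq x.2 | x <- l]).
pose t := [seq (x, y) | x <- zrange N, y <- zrange N].
apply: (@le_trans _ _ (\sum_(x <- t) `|a x.1 x.2|)).
  apply: ler_sum_uniq_sub => //.
  - apply: allpairs_uniq => // -[i j] [i' j'] _ _ /= /fi[-> ->] //.
  - by apply: allpairs_uniq; rewrite ?zrange_uniq// => -[? ?] [? ?] _ _ [-> ->].
  - move=> [x y] xl; apply/allpairsP; exists (x, y); split => //=; apply: sN;
      rewrite mem_cat; apply/orP; [left|right]; by apply/mapP; exists (x, y).
rewrite big_allpairs; apply: le_trans (aM N).
rewrite (big_zrange N (fun x => \sum_(j <- zrange N) `|a x j|)).
by apply: ler_sum => i _; rewrite (big_zrange N (fun y => `|a (i%:Z - N%:Z) y|)).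
Qed.

End absolutely_summable.

(** * Functions with a finite fourth moment *)

Section fourth_moment_class.
Context {R : realType} {d : measure_display} {T : measurableType d}.
Variable P : probability T R.
Implicit Types f g h k : T -> R.

Definition L4 f := measurable_fun setT f /\ L1 P (fun w => f w ^+ 4).

Lemma norm_mul4_le (a b c e : R) :
  `|a * b * c * e| <= a ^+ 4 + b ^+ 4 + c ^+ 4 + e ^+ 4.
Proof.
have h (x y : R) : `|x * y| <= x ^+ 2 + y ^+ 2.
  by rewrite ler_norml; apply/andP; split; nra.
rewrite -mulrA; apply: le_trans (h _ _) _.
have h2 (x y : R) : (x * y) ^+ 2 <= x ^+ 4 + y ^+ 4.
  have := h (x ^+ 2) (y ^+ 2); rewrite -!exprM exprMn => /(le_trans _) -> //.
  exact: ler_norm.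
by rewrite -addrA lerD.
Qed.

Lemma L1_mul4 f g h k : L4 f -> L4 g -> L4 h -> L4 k ->
  L1 P (fun w => f w * g w * h w * k w).
Proof.
move=> [mf Lf] [mg Lg] [mh Lh] [mk Lk].
apply: (L1_le (g := fun w => f w ^+ 4 + g w ^+ 4 + h w ^+ 4 + k w ^+ 4)).
- by do 3 apply: measurable_funM => //.
- by do 3 apply: L1D => //.
- by move=> w; exact: norm_mul4_le.
Qed.

Lemma L4_cst c : L4 (fun=> c).
Proof. by split; [exact: measurable_cst|exact: L1_cst]. Qed.

Lemma L1_mul2 f g : L4 f -> L4 g -> L1 P (fun w => f w * g w).
Proof.
move=> Lf Lg; have := L1_mul4 Lf Lg (L4_cst 1) (L4_cst 1).
by under eq_fun do rewrite !mulr1.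
Qed.

Lemma L1_sqr f : L4 f -> L1 P (fun w => f w ^+ 2).
Proof. by move=> Lf; have := L1_mul2 Lf Lf; under eq_fun do rewrite -expr2. Qed.

Lemma L4_L1 f : L4 f -> L1 P f.
Proof.
by move=> Lf; have := L1_mul2 Lf (L4_cst 1); under eq_fun do rewrite mulr1.
Qed.

Lemma L4Z c f : L4 f -> L4 (fun w => c * f w).
Proof.
move=> [mf Lf]; split; first exact: measurable_funM.
by under eq_fun do rewrite exprMn; exact: L1Z.
Qed.

Lemma L4D f g : L4 f -> L4 g -> L4 (fun w => f w + g w).
Proof.
move=> [mf Lf] [mg Lg]; split; first exact: measurable_funD.
apply: (L1_le (g := fun w => 8 * (f w ^+ 4 + g w ^+ 4))).
- by apply: measurable_funX; exact: measurable_funD.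
- by apply: L1Z; exact: L1D.
(* Used once on the pair and once on the squares, this produces the factor 2^2 times 2. *)
move=> w; have h (x y : R) : (x + y) ^+ 2 <= 2 * (x ^+ 2 + y ^+ 2).
  by have := sqr_ge0 (x - y); nra.
rewrite ger0_norm ?(exprn_even_ge0 (n := 4))//.
have -> : (f w + g w) ^+ 4 = ((f w + g w) ^+ 2) ^+ 2 by rewrite -exprM.
apply: (@le_trans _ _ ((2 * (f w ^+ 2 + g w ^+ 2)) ^+ 2)).
  by rewrite ler_pXn2r// ?nnegrE ?sqr_ge0// mulr_ge0// addr_ge0// sqr_ge0.
have := h (f w ^+ 2) (g w ^+ 2); rewrite -!exprM exprMn.
rewrite (_ : 2 * 2 = 4)%N// => h'.
rewrite (_ : 8 * _ = 2 ^+ 2 * (2 * (f w ^+ 4 + g w ^+ 4))); last by ring.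
by rewrite ler_wpM2l// exprn_ge0.
Qed.

Lemma L4_sum I (s : seq I) (F : I -> T -> R) :
  (forall i, L4 (F i)) -> L4 (fun w => \sum_(i <- s) F i w).
Proof.
move=> LF; elim: s => [|i s IH].
  by under eq_fun do rewrite big_nil; exact: L4_cst.
by under eq_fun do rewrite big_cons; exact: L4D.
Qed.

End fourth_moment_class.

(** * Moment bounds for sums of a stationary sequence *)

Section stationary_moments.
Context {R : realType} {d : measure_display} {T : measurableType d}.
Variables (P : probability T R) (Y : int -> T -> R).
Hypothesis HY : fourth_order_stationary P Y.
Notation gam := (gamma P Y).
Notation kap := (kappa P Y).

Lemma L4_stationary k : L4 P (Y k).
Proof. by split; [exact: HY.1|exact: HY.2.1]. Qed.

Lemma EE_mul2 (k l : int) : EE P (fun w => Y k w * Y l w) = gam (l - k).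
Proof.
have [_ h _ _] := HY.2.2 k 0 (l - k) 0 0.
by move: h; rewrite add0r addrC subrK /gamma => <-.
Qed.

Lemma gammaN h : gam (- h) = gam h.
Proof.
rewrite -[in RHS](subr0 h) -EE_mul2 -[in LHS](sub0r h) -EE_mul2.
by apply: eq_EE => w; rewrite mulrC.
Qed.

(** Shift invariance moves the first time to 0; the moment is then the cumulant plus the three
    pairings that a Gaussian sequence would give. *)
Lemma EE_mul4 (k l m o : int) : EE P (fun w => Y k w * Y l w * Y m w * Y o w) =
  kap (l - k) (m - k) (o - k) + (gam (l - k) * gam (m - o) +
    gam (m - k) * gam (l - o) + gam (o - k) * gam (l - m)).
Proof.
have [_ _ _ h] := HY.2.2 k 0 (l - k) (m - k) (o - k).
have e x : x - k + k = x by rewrite subrK.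
rewrite /kappa (_ : m - k - (o - k) = m - o); last by ring.
rewrite (_ : l - k - (o - k) = l - o); last by ring.
rewrite (_ : l - k - (m - k) = l - m); last by ring.
rewrite subrK; congr fine; move: h; rewrite !add0r => <-.
by rewrite ![k + _]addrC !e.
Qed.

Variables (G K : R).
Hypothesis HG : forall N : nat, \sum_(i < (N + N).+1) `|gam (i%:Z - N%:Z)| <= G.
Hypothesis HK : forall (h : int) (N : nat),
  \sum_(r < (N + N).+1) \sum_(s < (N + N).+1)
     `|kap h (r%:Z - N%:Z) (s%:Z - N%:Z)| <= K.

Lemma G_ge0 : 0 <= G.
Proof. by apply: le_trans (HG 0); rewrite sumr_ge0. Qed.

Lemma K_ge0 : 0 <= K.
Proof. by apply: le_trans (HK 0 0); rewrite sumr_ge0// => i _; rewrite sumr_ge0. Qed.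

Lemma gamma_sum_le (r : seq nat) (x : int) : uniq r ->
  \sum_(i <- r) `|gam (i%:Z - x)| <= G.
Proof. by move=> ur; apply: sum_inj_le => // i j /= h; lia. Qed.

Lemma gamma_sum_leN (r : seq nat) (x : int) : uniq r ->
  \sum_(i <- r) `|gam (x - i%:Z)| <= G.
Proof. by move=> ur; apply: sum_inj_le => // i j /= h; lia. Qed.

(** The shift in the second factor may depend on the outer index because the inner bound [G] is
    uniform in the shift. *)
Lemma gamma_sum2_le (r s : seq nat) (x : int) (f : nat -> int) : uniq r -> uniq s ->
  \sum_(i <- r) \sum_(j <- s) `|gam (i%:Z - x) * gam (f i - j%:Z)| <= G * G.
Proof.
move=> ur us; apply: (@le_trans _ _ (\sum_(i <- r) `|gam (i%:Z - x)| * G)).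
  apply: ler_sum => i _; under eq_bigr do rewrite normrM.
  by rewrite -mulr_sumr ler_wpM2l// gamma_sum_leN.
by rewrite -mulr_suml ler_wpM2r ?G_ge0// gamma_sum_le.
Qed.

Lemma size_index_iota1 n : size (index_iota 1 n.+1) = n.
Proof. by rewrite size_iota subn1. Qed.

Lemma sum_cst_seq (I : Type) (r : seq I) (c : R) :
  \sum_(i <- r) c = (size r)%:R * c.
Proof. by rewrite big_const_seq count_predT iter_addr_0 mulr_natl. Qed.

Lemma EE_sqr_sum_le (r : seq nat) : uniq r ->
  EE P (fun w => (\sum_(i <- r) Y i%:Z w) ^+ 2) <= (size r)%:R * G.
Proof.
move=> ur.
have -> : EE P (fun w => (\sum_(i <- r) Y i%:Z w) ^+ 2) =
    \sum_(i <- r) \sum_(j <- r) gam (j%:Z - i%:Z).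
  under eq_EE do rewrite expr2 big_distrlr/=.
  rewrite EE_sum; last first.
    by move=> i; apply: L1_sum => j; apply: L1_mul2; exact: L4_stationary.
  apply: eq_bigr => i _; rewrite EE_sum; last first.
    by move=> j; apply: L1_mul2; exact: L4_stationary.
  by apply: eq_bigr => j _; exact: EE_mul2.
rewrite -sum_cst_seq; apply: ler_sum => i _.
apply: le_trans (ler_norm _) _; apply: le_trans (ler_norm_sum _ _ _) _.
exact: gamma_sum_le.
Qed.

(** In each of the four contributions two indices can be held fixed while the sum over the other two
    stays bounded: by K for the cumulant, which is condition (c), and by G^2 for each pairing. The
    fixed indices account for the square of the size. *)
Lemma EE_pow4_sum_le (r : seq nat) : uniq r ->
  EE P (fun w => (\sum_(i <- r) Y i%:Z w) ^+ 4) <=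
    (size r)%:R ^+ 2 * (K + 3 * (G * G)).
Proof.
move=> ur; have L := L4_stationary.
have expand w : (\sum_(i <- r) Y i%:Z w) ^+ 4 = \sum_(i <- r) \sum_(j <- r)
    \sum_(k <- r) \sum_(l <- r) Y i%:Z w * Y j%:Z w * Y k%:Z w * Y l%:Z w.
  symmetry; under eq_bigr do under eq_bigr do under eq_bigr do rewrite -mulr_sumr.
  under eq_bigr do under eq_bigr do rewrite -mulr_suml -mulr_sumr.
  under eq_bigr do rewrite -!mulr_suml -mulr_sumr.
  by rewrite -!mulr_suml !exprS expr0 mulr1 !mulrA.
have -> : EE P (fun w => (\sum_(i <- r) Y i%:Z w) ^+ 4) =
    \sum_(i <- r) \sum_(j <- r) \sum_(k <- r) \sum_(l <- r)
      (kap (j%:Z - i%:Z) (k%:Z - i%:Z) (l%:Z - i%:Z) +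
       (gam (j%:Z - i%:Z) * gam (k%:Z - l%:Z) +
        gam (k%:Z - i%:Z) * gam (j%:Z - l%:Z) +
        gam (l%:Z - i%:Z) * gam (j%:Z - k%:Z))).
  under eq_EE do rewrite expand.
  have L4' i j k l : L1 P (fun w => Y i w * Y j w * Y k w * Y l w) by exact: L1_mul4.
  rewrite EE_sum; last by move=> i; do 3 apply: L1_sum => ?.
  apply: eq_bigr => i _; rewrite EE_sum; last by move=> ?; do 2 apply: L1_sum => ?.
  apply: eq_bigr => j _; rewrite EE_sum; last by move=> ?; apply: L1_sum => ?.
  apply: eq_bigr => k _; rewrite EE_sum//.
  by apply: eq_bigr => l _; exact: EE_mul4.
have n0 : 0 <= (size r)%:R :> R by [].
have -> : (size r)%:R ^+ 2 * (K + 3 * (G * G)) =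
    (size r)%:R * ((size r)%:R * K) + ((size r)%:R * ((size r)%:R * (G * G)) +
    (size r)%:R * ((size r)%:R * (G * G)) + (size r)%:R * ((size r)%:R * (G * G))).
  by ring.
(* With [kappa] abstracted, the splitting acts only on the cumulant and the three pairings, not
   inside the body of [kappa]. *)
move: (kappa P Y) HK => kp Hkp.
under eq_bigr do under eq_bigr do under eq_bigr do rewrite !big_split/=.
under eq_bigr do under eq_bigr do rewrite !big_split/=.
under eq_bigr do rewrite !big_split/=.
rewrite !big_split/=.
have cc (c : R) : (size r)%:R * ((size r)%:R * c) = \sum_(i <- r) \sum_(j <- r) c.
  by rewrite !sum_cst_seq.
rewrite !cc.
apply: lerD; [|apply: lerD; [apply: lerD|]].
- apply: ler_sum => i _; apply: ler_sum => j _.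
  apply: (@le_trans _ _ (\sum_(k <- r) \sum_(l <- r)
      `|kp (j%:Z - i%:Z) (k%:Z - i%:Z) (l%:Z - i%:Z)|)).
    by apply: ler_sum => k _; apply: ler_sum => l _; exact: ler_norm.
  apply: (sum_inj2_le (f := fun k l : nat => (k%:Z - i%:Z, l%:Z - i%:Z))
    (a := kp (j%:Z - i%:Z))) => //.
  by move=> k l k' l' [] h1 h2; split; lia.
(* The pairs here are (i, j) and (k, l); the fixed indices must be one from each pair, [i] and [k],
   hence the exchange. *)
- apply: ler_sum => i _; rewrite exchange_big/=; apply: ler_sum => k _.
  apply: (@le_trans _ _ (\sum_(j <- r) \sum_(l <- r)
      `|gam (j%:Z - i%:Z) * gam (k%:Z - l%:Z)|)).
    by apply: ler_sum => j _; apply: ler_sum => l _; exact: ler_norm.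
  exact: (gamma_sum2_le i%:Z (fun=> k%:Z)).
- apply: ler_sum => i _; apply: ler_sum => j _.
  apply: (@le_trans _ _ (\sum_(k <- r) \sum_(l <- r)
      `|gam (k%:Z - i%:Z) * gam (j%:Z - l%:Z)|)).
    by apply: ler_sum => k _; apply: ler_sum => l _; exact: ler_norm.
  exact: (gamma_sum2_le i%:Z (fun=> j%:Z)).
- apply: ler_sum => i _; apply: ler_sum => j _; rewrite exchange_big/=.
  apply: (@le_trans _ _ (\sum_(l <- r) \sum_(k <- r)
      `|gam (l%:Z - i%:Z) * gam (j%:Z - k%:Z)|)).
    by apply: ler_sum => k _; apply: ler_sum => l _; exact: ler_norm.
  exact: (gamma_sum2_le i%:Z (fun=> j%:Z)).
Qed.

(** Enlarging the square by one adds a diagonal term [gam 0], and a row and a column that both sum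
    to gam 1 + ... + gam n because [gam] is even. *)
Lemma sum_gamma_square n :
  \sum_(1 <= i < n.+1) \sum_(1 <= j < n.+1) gam (j%:Z - i%:Z) =
  n%:R * gam 0 + 2 * \sum_(1 <= j < n) (n - j)%:R * gam j%:Z.
Proof.
elim: n => [|n IH]; first by rewrite !big_geq// mul0r mulr0 addr0.
rewrite big_nat_recr//= [in X in _ + X]big_nat_recr//= subrr.
under eq_bigr do rewrite big_nat_recr//=.
rewrite big_split/= IH.
have rv : \sum_(1 <= j < n.+1) gam (n.+1%:Z - j%:Z) = \sum_(1 <= j < n.+1) gam j%:Z.
  rewrite [RHS]big_nat_rev/=; apply: eq_big_nat => j /andP[j1 jn].
  by congr gam; lia.
have -> : \sum_(1 <= j < n.+1) gam (j%:Z - n.+1%:Z) = \sum_(1 <= j < n.+1) gam j%:Z.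
  by rewrite -rv; apply: eq_bigr => j _; rewrite -gammaN opprB.
rewrite rv.
have -> : \sum_(1 <= j < n.+1) (n.+1 - j)%:R * gam j%:Z =
    \sum_(1 <= j < n) (n - j)%:R * gam j%:Z + \sum_(1 <= j < n.+1) gam j%:Z.
  case: n {IH rv} => [|n]; first by rewrite !big_geq// addr0.
  (* A term of weight zero is appended so that all sums run over the same range. *)
  have -> : \sum_(1 <= j < n.+1) (n.+1 - j)%:R * gam j%:Z =
      \sum_(1 <= j < n.+2) (n.+1 - j)%:R * gam j%:Z.
    by rewrite [RHS]big_nat_recr//= subnn mul0r addr0.
  rewrite -big_split/=; apply: eq_big_nat => j /andP[j1 jn].
  by rewrite subSn// -addn1 natrD mulrDl mul1r.
rewrite -[n.+1]addn1 natrD; ring.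
Qed.

Lemma EE_sqr_partial_sum n : (0 < n)%N ->
  EE P (fun w => (\sum_(1 <= i < n.+1) Y i%:Z w) ^+ 2) =
  n%:R * (gam 0 + 2 * \sum_(1 <= j < n) (1 - j%:R / n%:R) * gam j%:Z).
Proof.
move=> n0; under eq_EE do rewrite expr2 big_distrlr/=.
rewrite EE_sum; last first.
  by move=> i; apply: L1_sum => j; apply: L1_mul2; exact: L4_stationary.
transitivity (\sum_(1 <= i < n.+1) \sum_(1 <= j < n.+1) gam (j%:Z - i%:Z)).
  apply: eq_bigr => i _; rewrite EE_sum; last first.
    by move=> j; apply: L1_mul2; exact: L4_stationary.
  by apply: eq_bigr => j _; exact: EE_mul2.
rewrite sum_gamma_square [RHS]mulrDr [in RHS]mulrCA [in X in _ = _ + _ * X]mulr_sumr; congr (_ + 2 * _).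
apply: eq_big_nat => j /andP[_ jn]; rewrite natrB ?(ltnW jn)//.
by field; rewrite pnatr_eq0 -lt0n.
Qed.

End stationary_moments.

(** * Variance of the estimator with known mean *)

Section long_run_variance.
Context {R : realType} {d : measure_display} {T : measurableType d}.
Variables (P : probability T R) (Y : int -> T -> R).
Hypothesis HY : fourth_order_stationary P Y.
Notation gam := (gamma P Y).
Notation kap := (kappa P Y).
Variables (G K : R).
Hypothesis HG : forall N : nat, \sum_(i < (N + N).+1) `|gam (i%:Z - N%:Z)| <= G.
Hypothesis HK : forall (h : int) (N : nat),
  \sum_(r < (N + N).+1) \sum_(s < (N + N).+1)
     `|kap h (r%:Z - N%:Z) (s%:Z - N%:Z)| <= K.
Let G0 : 0 <= G := G_ge0 HG.
Let K0 : 0 <= K := K_ge0 HK.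

(* The weight of the j-th autocovariance, so that s_n^2 is a single sum over j. *)
Definition bartlett (Q j : nat) : R :=
  if j == 0%N then 1 else if (j <= Q)%N then 2 * omega_w Q j else 0.

Lemma bartlett_le2 Q j : `|bartlett Q j| <= 2.
Proof.
rewrite /bartlett /omega_w; case: eqP => [_|_]; first by rewrite normr1 ler1n.
case: leqP => jQ; last by rewrite normr0.
have j1 : j%:R / Q.+1%:R <= 1 :> R.
  by rewrite ler_pdivrMr ?ltr0n// mul1r ler_nat ltnW.
have j0 : 0 <= j%:R / Q.+1%:R :> R by rewrite divr_ge0.
rewrite normrM (ger0_norm (x := 2))// -[leRHS]mulr1 ler_wpM2l//.
by rewrite ger0_norm ?subr_ge0// lerBlDr lerDl.
Qed.

Lemma bartlett_sum Q (F : nat -> R) :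
  F 0%N + 2 * \sum_(1 <= j < Q.+1) omega_w Q j * F j =
  \sum_(0 <= j < Q.+1) bartlett Q j * F j.
Proof.
rewrite [RHS]big_ltn// [in X in _ = X + _]/bartlett/= mul1r mulr_sumr; congr (_ + _).
apply: eq_big_nat => -[|j]// /andP[_ jQ].
by rewrite /bartlett/= -ltnS jQ mulrA.
Qed.

(** The sample autocovariance centred at the true mean, since X_i - mu = Y_i. *)
Definition gammatilde (n j : nat) (w : T) : R :=
  n%:R^-1 * \sum_(1 <= i < (n - j).+1) Y i%:Z w * Y (i + j)%:Z w.

Definition s2tilde (n Q : nat) (w : T) : R :=
  \sum_(0 <= j < Q.+1) bartlett Q j * gammatilde n j w.

(** The expectation of [s2tilde]; the factor n - j counts the products available at lag j. *)
Definition s2tilde_mean (n Q : nat) : R :=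
  \sum_(0 <= j < Q.+1) bartlett Q j * (n%:R^-1 * ((n - j)%:R * gam j%:Z)).

(** The v_N of the overview; at N = Q + 1 its weights are those of [omega_w Q]. *)
Definition lrv (N : nat) : R :=
  gam 0 + 2 * \sum_(1 <= j < N) (1 - j%:R / N%:R) * gam j%:Z.

(** Centring removes the pairing [gam j * gam k] and leaves the cumulant and the two cross pairings.
    Evenness of [gam] brings these to the shape bounded by [gamma_sum2_le], with [l] as outer and
    [k] as inner index. *)
Let prod_cov i j l k : EE P (fun w => (Y i%:Z w * Y (i + j)%N%:Z w - gam j%:Z) *
    (Y l%:Z w * Y (l + k)%N%:Z w - gam k%:Z)) =
  kap j%:Z (l%:Z - i%:Z) ((l + k)%N%:Z - i%:Z) +
  gam (l%:Z - i%:Z) * gam (i%:Z + j%:Z - l%:Z - k%:Z) +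
  gam (l%:Z - (i%:Z + j%:Z)) * gam (i%:Z - l%:Z - k%:Z).
Proof.
have L := L4_stationary HY.
under eq_EE do rewrite mulrBl mulrBr [gam j%:Z * _]mulrBr.
have L2 a b : L1 P (fun w => Y a w * Y b w) by exact: L1_mul2.
have L4' : L1 P (fun w => Y i%:Z w * Y (i + j)%N%:Z w * (Y l%:Z w * Y (l + k)%N%:Z w)).
  by under eq_fun do rewrite mulrA; exact: L1_mul4.
rewrite EEB; [|by apply: L1B => //; exact: L1Zr|by apply: L1B; [exact: L1Z|exact: L1_cst]].
rewrite EEB//; last exact: L1Zr.
rewrite EEB; [|exact: L1Z|exact: L1_cst].
rewrite EEZr// EEZ// EE_cst !(EE_mul2 HY).
under eq_EE do rewrite mulrA.
rewrite (EE_mul4 HY).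
rewrite (_ : (i + j)%N%:Z - i%:Z = j%:Z); last by rewrite PoszD; ring.
rewrite (_ : (l + k)%N%:Z - l%:Z = k%:Z); last by rewrite PoszD; ring.
rewrite (_ : l%:Z - (l + k)%N%:Z = - k%:Z); last by rewrite PoszD; ring.
rewrite (gammaN HY).
rewrite (_ : gam ((l + k)%N%:Z - i%:Z) = gam (i%:Z - l%:Z - k%:Z)); last first.
  by rewrite -(gammaN HY); congr gam; rewrite PoszD; ring.
rewrite (_ : gam ((i + j)%N%:Z - l%:Z) = gam (l%:Z - (i%:Z + j%:Z))); last first.
  by rewrite -(gammaN HY); congr gam; rewrite PoszD; ring.
rewrite (_ : (i + j)%N%:Z - (l + k)%N%:Z = i%:Z + j%:Z - l%:Z - k%:Z); last first.
  by rewrite !PoszD; ring.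
ring.
Qed.

(** The square is n^-2 times a sum over (j, i, k, l). For a fixed lag j and position i the sum over
    (k, l) is bounded by a constant, and there are at most (Q + 1) n pairs (j, i). The factor 4
    comes from two weights bounded by 2. *)
Lemma s2tilde_variance n Q : (0 < n)%N ->
  L1 P (fun w => (s2tilde n Q w - s2tilde_mean n Q) ^+ 2) /\
  EE P (fun w => (s2tilde n Q w - s2tilde_mean n Q) ^+ 2) <=
  4 * (K + 2 * (G * G)) * (Q.+1%:R / n%:R).
Proof.
move=> n0; have L := L4_stationary HY.
have nn0 : n%:R != 0 :> R by rewrite pnatr_eq0 -lt0n.
pose I j := index_iota 1 (n - j).+1.
pose J := index_iota 0 Q.+1.
pose X j i w := bartlett Q j * (Y i%:Z w * Y (i + j)%N%:Z w - gam j%:Z).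
have E w : s2tilde n Q w - s2tilde_mean n Q =
    n%:R^-1 * \sum_(j <- J) \sum_(i <- I j) X j i w.
  rewrite /s2tilde /s2tilde_mean -sumrB mulr_sumr; apply: eq_bigr => j _.
  rewrite -mulr_sumr sumrB sum_cst_seq size_index_iota1 /gammatilde; ring.
have L2 j i k l : L1 P (fun w => X j i w * X k l w).
  under eq_fun do rewrite /X mulrACA.
  apply: L1Z; under eq_fun do rewrite mulrBl mulrBr [gam j%:Z * _]mulrBr.
  apply: L1B; apply: L1B.
  - by under eq_fun do rewrite mulrA; exact: L1_mul4.
  - by apply: L1Zr; exact: L1_mul2.
  - by apply: L1Z; exact: L1_mul2.
  - exact: L1_cst.
have expand w : (\sum_(j <- J) \sum_(i <- I j) X j i w) ^+ 2 =
    \sum_(j <- J) \sum_(i <- I j) \sum_(k <- J) \sum_(l <- I k) X j i w * X k l w.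
  rewrite expr2 mulr_suml; apply: eq_bigr => j _.
  rewrite mulr_suml; apply: eq_bigr => i _.
  by rewrite mulr_sumr; apply: eq_bigr => k _; rewrite mulr_sumr.
under eq_fun do rewrite E exprMn expand.
split; first by apply: L1Z; do 4 apply: L1_sum => ?.
rewrite EEZ; last by do 4 apply: L1_sum => ?.
pose C := K + 2 * (G * G).
pose Z j i k l := `|kap j%:Z (l%:Z - i%:Z) ((l + k)%N%:Z - i%:Z)| +
  (`|gam (l%:Z - i%:Z) * gam (i%:Z + j%:Z - l%:Z - k%:Z)| +
   `|gam (l%:Z - (i%:Z + j%:Z)) * gam (i%:Z - l%:Z - k%:Z)|).
have Z0 j i k l : 0 <= Z j i k l by rewrite !addr_ge0.
have XZ j i k l : EE P (fun w => X j i w * X k l w) <= 4 * Z j i k l.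
  have -> : EE P (fun w => X j i w * X k l w) = bartlett Q j * bartlett Q k *
      EE P (fun w => (Y i%:Z w * Y (i + j)%N%:Z w - gam j%:Z) *
                     (Y l%:Z w * Y (l + k)%N%:Z w - gam k%:Z)).
    under eq_EE do rewrite /X mulrACA.
    rewrite EEZ//; under eq_fun do rewrite mulrBl mulrBr [gam j%:Z * _]mulrBr.
    apply: L1B; apply: L1B.
    - by under eq_fun do rewrite mulrA; exact: L1_mul4.
    - by apply: L1Zr; exact: L1_mul2.
    - by apply: L1Z; exact: L1_mul2.
    - exact: L1_cst.
  rewrite prod_cov; apply: le_trans (ler_norm _) _; rewrite normrM.
  apply: ler_pM => //.
    rewrite normrM (_ : 4 = 2 * 2); last by ring.
    by apply: ler_pM => //; exact: bartlett_le2.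
  by rewrite -addrA; apply: le_trans (ler_normD _ _) _; rewrite lerD2l ler_normD.
have iu k : uniq (index_iota 1 k) by exact: iota_uniq.
have IS j : {subset I j <= index_iota 1 n.+1}.
  by move=> i; rewrite !mem_index_iota; lia.
(* The range of [l] depends on [k]; it is enlarged to 1..n, which is allowed since [Z] is
   nonnegative, so that the two sums can be exchanged. *)
have ZC j i : \sum_(k <- J) \sum_(l <- index_iota 1 n.+1) Z j i k l <= C.
  rewrite /Z; under eq_bigr do rewrite !big_split/=; rewrite !big_split/=.
  rewrite /C mulr2n mulrDl mul1r; apply: lerD; [|apply: lerD].
  - apply: (sum_inj2_le (f := fun k l : nat => (l%:Z - i%:Z, (l + k)%N%:Z - i%:Z))
      (a := kap j%:Z)) => //; first exact: iota_uniq.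
    by move=> k l k' l' [] h1 h2; split; lia.
  - rewrite exchange_big/=.
    exact: (gamma_sum2_le HG i%:Z (fun l => i%:Z + j%:Z - l%:Z) (iu _) (iota_uniq _ _)).
  - rewrite exchange_big/=.
    exact: (gamma_sum2_le HG (i%:Z + j%:Z) (fun l => i%:Z - l%:Z) (iu _) (iota_uniq _ _)).
have main : EE P (fun w => \sum_(j <- J) \sum_(i <- I j) \sum_(k <- J)
    \sum_(l <- I k) X j i w * X k l w) <= Q.+1%:R * (n%:R * (4 * C)).
  rewrite EE_sum; last by move=> ?; do 3 apply: L1_sum => ?.
  rewrite (_ : Q.+1%:R = (size J)%:R); last by rewrite size_iota subn0.
  rewrite -sum_cst_seq; apply: ler_sum => j _.
  rewrite EE_sum; last by move=> ?; do 2 apply: L1_sum => ?.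
  apply: (@le_trans _ _ (\sum_(i <- I j) 4 * C)); last first.
    rewrite sum_cst_seq size_index_iota1 ler_wpM2r ?ler_nat ?leq_subr//.
    by rewrite mulr_ge0// addr_ge0// !mulr_ge0.
  apply: ler_sum => i _; rewrite EE_sum; last by move=> ?; apply: L1_sum => ?.
  apply: (@le_trans _ _ (4 * \sum_(k <- J) \sum_(l <- index_iota 1 n.+1) Z j i k l)).
    rewrite mulr_sumr; apply: ler_sum => k _; rewrite EE_sum//.
    apply: (@le_trans _ _ (4 * \sum_(l <- I k) Z j i k l)).
      by rewrite mulr_sumr; apply: ler_sum => l _; exact: XZ.
    by rewrite ler_wpM2l//; apply: (ler_sum_uniq_sub (iu _) (iu _) (@IS k)) => l; exact: Z0.
  by rewrite ler_wpM2l.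
apply: (@le_trans _ _ (n%:R^-1 ^+ 2 * (Q.+1%:R * (n%:R * (4 * C))))).
  by rewrite ler_wpM2l// sqr_ge0.
by rewrite le_eqVlt; apply/orP; left; apply/eqP; rewrite /C; field.
Qed.

End long_run_variance.

(** * L^1 distance between s_n^2 and the long-run variance *)

Section estimator_consistency.
Context {R : realType} {d : measure_display} {T : measurableType d}.
Variables (P : probability T R) (Y : int -> T -> R).
Hypothesis HY : fourth_order_stationary P Y.
Notation gam := (gamma P Y).
Notation kap := (kappa P Y).
Variables (G K : R).
Hypothesis HG : forall N : nat, \sum_(i < (N + N).+1) `|gam (i%:Z - N%:Z)| <= G.
Hypothesis HK : forall (h : int) (N : nat),
  \sum_(r < (N + N).+1) \sum_(s < (N + N).+1)
     `|kap h (r%:Z - N%:Z) (s%:Z - N%:Z)| <= K.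
Variables (mu : R) (q : nat -> nat).
Let G0 : 0 <= G := G_ge0 HG.

(** The terms differ only by the factor (n - j)/n, which is within (Q + 1)/n of 1 for j <= Q. *)
Lemma s2tilde_mean_lrv n Q : (0 < n)%N ->
  `|s2tilde_mean P Y n Q - lrv P Y Q.+1| <= 2 * G * (Q.+1%:R / n%:R).
Proof.
move=> n0; have nn : 0 < n%:R :> R by rewrite ltr0n.
rewrite /lrv -/(omega_w Q) (bartlett_sum Q (fun j => gam j%:Z)) /s2tilde_mean -sumrB.
apply: (@le_trans _ _ (\sum_(0 <= j < Q.+1) 2 * (Q.+1%:R / n%:R) * `|gam (j%:Z - 0)|)).
  apply: le_trans (ler_norm_sum _ _ _) _; apply: ler_sum_nat => j /andP[_ jQ].
  rewrite subr0 -mulrBr normrM -mulrA ler_pM ?bartlett_le2//.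
  rewrite (_ : _ - _ = (n%:R^-1 * (n - j)%:R - 1) * gam j%:Z); last by ring.
  rewrite normrM ler_wpM2r// distrC ger0_norm; last first.
    by rewrite subr_ge0 mulrC ler_pdivrMr// mul1r ler_nat leq_subr.
  rewrite lerBlDr -(ler_pM2r nn) mul1r mulrDl divfK ?gt_eqF// mulrAC mulVf ?gt_eqF//.
  rewrite mul1r -natrD ler_nat; lia.
rewrite -mulr_sumr [leRHS]mulrAC ler_wpM2l ?mulr_ge0//.
exact: (gamma_sum_le HG 0 (iota_uniq _ _)).
Qed.

(** Weighted arithmetic-geometric mean inequality. The free weight balances factors of different
    size, and with one factor equal to 1 it bounds a first moment by a second one. *)
Lemma mul_norm_le (a b m : R) : 0 < m -> `|a * b| <= m * a ^+ 2 / 2 + b ^+ 2 / m / 2.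
Proof.
move=> m0; rewrite -subr_ge0.
have h : 0 <= (m * `|a| - `|b|) ^+ 2 / m / 2 by rewrite !divr_ge0 ?sqr_ge0// ltW.
rewrite normrM -(real_normK (num_real a)) -(real_normK (num_real b)).
rewrite (_ : _ - _ = (m * `|a| - `|b|) ^+ 2 / m / 2)//.
by field; rewrite gt_eqF.
Qed.

Let S n w := \sum_(1 <= i < n.+1) Y i%:Z w.

Lemma Xs_sub_Xbar n i w : (0 < n)%N ->
  Xs mu Y i w - Xbar mu Y n w = Y i%:Z w - S n w / n%:R.
Proof.
move=> n0; rewrite /Xbar /Xs big_split/= sumr_const_nat subn1/= -mulr_natr.
by rewrite /S; field; rewrite pnatr_eq0 -lt0n.
Qed.

Lemma gammahat_expand n j w : (0 < n)%N ->
  let Sj := \sum_(i <- index_iota 1 (n - j).+1) Y i%:Z w in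
  let Sj' := \sum_(i <- index_iota 1 (n - j).+1) Y (i + j)%N%:Z w in
  gammahat mu Y n j w - gammatilde Y n j w =
  n%:R^-1 * ((n - j)%:R * (S n w / n%:R) ^+ 2 - S n w / n%:R * Sj - S n w / n%:R * Sj').
Proof.
move=> n0 Sj Sj'; rewrite /gammahat /gammatilde -mulrBr; congr (_ * _).
have -> : (n - j)%:R * (S n w / n%:R) ^+ 2 =
    \sum_(i <- index_iota 1 (n - j).+1) (S n w / n%:R) ^+ 2.
  by rewrite sum_cst_seq size_index_iota1.
rewrite -sumrB /Sj /Sj' !mulr_sumr -!sumrB.
by apply: eq_bigr => i _; rewrite !Xs_sub_Xbar//; ring.
Qed.

Lemma L1_gammahat n j : (0 < n)%N -> L1 P (gammahat mu Y n j).
Proof.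
move=> n0; have L := L4_stationary HY.
have LS : L4 P (S n) by apply: L4_sum.
apply: L1Z; apply: L1_sum => i.
under eq_fun do rewrite !Xs_sub_Xbar//.
have h k : L4 P (fun w => Y k w - S n w / n%:R).
  rewrite (_ : (fun _ => _) = (fun w => Y k w + - n%:R^-1 * S n w)).
    by apply: L4D => //; exact: L4Z.
  by apply/funext => w; rewrite mulNr mulrC.
exact: L1_mul2.
Qed.

Lemma L1_gammatilde n j : L1 P (gammatilde Y n j).
Proof. by apply: L1Z; apply: L1_sum => i; apply: L1_mul2; exact: (L4_stationary HY). Qed.

(** The corrections are at most (S_n/n)^2, and n^-1 times S_n/n times a sum of at most n terms. Here
    S_n/n has second moment at most G/n and the sums at most n G, so all are O(1/n) in mean,
    uniformly in the lag. *)
Lemma gammahat_gammatilde_dist n j : (0 < n)%N ->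
  EE P (fun w => `|gammahat mu Y n j w - gammatilde Y n j w|) <= 3 * G / n%:R.
Proof.
move=> n0; have nn : 0 < n%:R :> R by rewrite ltr0n.
have L := L4_stationary HY.
pose r := index_iota 1 (n - j).+1.
pose Sj w := \sum_(i <- r) Y i%:Z w.
pose Sj' w := \sum_(i <- r) Y (i + j)%N%:Z w.
have LS : L4 P (S n) by apply: L4_sum.
have LSj : L4 P Sj by apply: L4_sum.
have LSj' : L4 P Sj' by apply: L4_sum.
have ES : EE P (fun w => S n w ^+ 2) <= n%:R * G.
  have := EE_sqr_sum_le HY HG (iota_uniq 1 (n.+1 - 1) : uniq (index_iota 1 n.+1)).
  by rewrite size_index_iota1.
have nj : (n - j)%:R * G <= n%:R * G by rewrite ler_wpM2r// ler_nat leq_subr.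
have ESj : EE P (fun w => Sj w ^+ 2) <= n%:R * G.
  apply: le_trans nj; have := EE_sqr_sum_le HY HG (iota_uniq 1 _ : uniq r).
  by rewrite size_index_iota1.
have ESj' : EE P (fun w => Sj' w ^+ 2) <= n%:R * G.
  apply: le_trans nj; have ur : uniq [seq (i + j)%N | i <- r].
    by rewrite map_inj_uniq ?iota_uniq// => a b; lia.
  have -> : EE P (fun w => Sj' w ^+ 2) =
      EE P (fun w => (\sum_(i <- [seq (i + j)%N | i <- r]) Y i%:Z w) ^+ 2).
    by apply: eq_EE => w; rewrite big_map.
  by have := EE_sqr_sum_le HY HG ur; rewrite size_map size_index_iota1.
(* The majorant that [mul_norm_le] gives with weight n; its two parts have means at most 2 G/n and
   G/n. *)
pose B w := 2 * (n%:R ^+ 2)^-1 * S n w ^+ 2 +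
  (2 * n%:R ^+ 2)^-1 * (Sj w ^+ 2 + Sj' w ^+ 2).
have LB : L1 P B.
  by apply: L1D; apply: L1Z; [|apply: L1D]; exact: L1_sqr.
apply: (@le_trans _ _ (EE P B)).
  apply: EE_le => //.
    by apply: L1_abs; apply: L1B; [exact: L1_gammahat|exact: L1_gammatilde].
  move=> w; rewrite gammahat_expand// normrM gtr0_norm ?invr_gt0//.
  rewrite -/(Sj w) -/(Sj' w).
  rewrite mulrC ler_pdivrMr//.
  set y := S n w / n%:R.
  have h1 := mul_norm_le y (Sj w) nn.
  have h2 := mul_norm_le y (Sj' w) nn.
  have h3 : `|(n - j)%:R * y ^+ 2| <= n%:R * y ^+ 2.
    have y2 := sqr_ge0 y; rewrite ger0_norm; last exact: mulr_ge0.
    by apply: ler_wpM2r => //; rewrite ler_nat leq_subr.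
  apply: le_trans (ler_normB _ _) _; apply: (@le_trans _ _ (n%:R * y ^+ 2 +
      (n%:R * y ^+ 2 / 2 + Sj w ^+ 2 / n%:R / 2) +
      (n%:R * y ^+ 2 / 2 + Sj' w ^+ 2 / n%:R / 2))).
    by apply: lerD => //; apply: le_trans (ler_normB _ _) _; apply: lerD.
  rewrite le_eqVlt; apply/orP; left; apply/eqP.
  by rewrite /B /y; field; rewrite gt_eqF.
rewrite EED; [|by apply: L1Z; exact: L1_sqr|by apply: L1Z; apply: L1D; exact: L1_sqr].
rewrite !EEZ; [|by apply: L1D; exact: L1_sqr|exact: L1_sqr].
rewrite EED; [|exact: L1_sqr|exact: L1_sqr].
apply: (@le_trans _ _ (2 * (n%:R ^+ 2)^-1 * (n%:R * G) +
    (2 * n%:R ^+ 2)^-1 * (n%:R * G + n%:R * G))).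
  have c0 : 0 <= (n%:R ^+ 2)^-1 :> R by rewrite invr_ge0 exprn_ge0.
  apply: lerD; first by apply: ler_wpM2l => //; apply: mulr_ge0.
  by rewrite invfM; apply: ler_wpM2l; [rewrite mulr_ge0// invr_ge0|exact: lerD].
by rewrite le_eqVlt; apply/orP; left; apply/eqP; field; rewrite gt_eqF.
Qed.

Lemma s2E n w : s2 mu Y q n w =
  \sum_(0 <= j < (q n).+1) bartlett (q n) j * gammahat mu Y n j w.
Proof. by rewrite /s2 (bartlett_sum (q n) (fun j => gammahat mu Y n j w)). Qed.

Lemma L1_s2 n : (0 < n)%N -> L1 P (s2 mu Y q n).
Proof.
move=> n0; rewrite (funext (s2E n)).
by apply: L1_sum => j; apply: L1Z; exact: L1_gammahat.
Qed.

Lemma L1_s2tilde n Q : L1 P (s2tilde Y n Q).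
Proof. by apply: L1_sum => j; apply: L1Z; exact: L1_gammatilde. Qed.

Lemma s2_s2tilde_dist n : (0 < n)%N ->
  EE P (fun w => `|s2 mu Y q n w - s2tilde Y n (q n) w|) <=
  6 * G * ((q n).+1%:R / n%:R).
Proof.
move=> n0; pose J := index_iota 0 (q n).+1.
pose D j w := `|gammahat mu Y n j w - gammatilde Y n j w|.
have LD j : L1 P (D j).
  by apply: L1_abs; apply: L1B; [exact: L1_gammahat|exact: L1_gammatilde].
apply: (@le_trans _ _ (EE P (fun w => \sum_(j <- J) 2 * D j w))).
  apply: EE_le => [||w].
  - by apply: L1_abs; apply: L1B; [exact: L1_s2|exact: L1_s2tilde].
  - by apply: L1_sum => j; exact: L1Z.
  rewrite s2E /s2tilde -sumrB; apply: le_trans (ler_norm_sum _ _ _) _.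
  by apply: ler_sum => j _; rewrite -mulrBr normrM ler_wpM2r ?bartlett_le2.
rewrite EE_sum; last by move=> j; exact: L1Z.
apply: (@le_trans _ _ (\sum_(j <- J) 2 * (3 * G / n%:R))).
  by apply: ler_sum => j _; rewrite EEZ// ler_wpM2l// gammahat_gammatilde_dist.
rewrite sum_cst_seq size_iota subn0 le_eqVlt; apply/orP; left; apply/eqP.
by field; rewrite pnatr_eq0 -lt0n.
Qed.

(** Besides |v_(q+1) - sig| there are three errors: the estimated mean (6 G), the bias (2 G) and the
    fluctuation of [s2tilde]. The last passes from variance to L^1 by |x| <= x^2/e + e, which leaves
    [e] free. *)
Lemma s2_dist n (sig e : R) : (0 < n)%N -> 0 < e ->
  EE P (fun w => `|s2 mu Y q n w - sig|) <=
  e + `|lrv P Y (q n).+1 - sig| +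
  (8 * G + 4 * (K + 2 * (G * G)) / e) * ((q n).+1%:R / n%:R).
Proof.
move=> n0 e0; set Q := q n; set m := s2tilde_mean P Y n Q.
set t := Q.+1%:R / n%:R.
have [LD2 V] := s2tilde_variance HY HG HK Q n0.
have L1d := L1_abs (L1B (L1_s2 n0) (L1_s2tilde n Q)).
have -> : 8 * G + 4 * (K + 2 * (G * G)) / e =
    6 * G + (4 * (K + 2 * (G * G))) / e + 2 * G by ring.
pose B w := `|s2 mu Y q n w - s2tilde Y n Q w| +
  (e^-1 * (s2tilde Y n Q w - m) ^+ 2 + (e + (`|m - lrv P Y Q.+1| + `|lrv P Y Q.+1 - sig|))).
have LB1 : L1 P (fun w => e^-1 * (s2tilde Y n Q w - m) ^+ 2 +
    (e + (`|m - lrv P Y Q.+1| + `|lrv P Y Q.+1 - sig|))).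
  by apply: L1D; [exact: L1Z|exact: L1_cst].
apply: (@le_trans _ _ (EE P B)).
  apply: EE_le => [||w].
  - by apply: L1_abs; apply: L1B; [exact: L1_s2|exact: L1_cst].
  - exact: L1D.
  set x := s2tilde Y n Q w.
  have h : `|x - m| <= e^-1 * (x - m) ^+ 2 + e.
    have := mul_norm_le 1 (x - m) e0; rewrite mul1r expr1n mulr1 => /le_trans; apply.
    have y0 : 0 <= (x - m) ^+ 2 / e by rewrite divr_ge0 ?sqr_ge0// ltW.
    rewrite [e^-1 * _]mulrC; lra.
  rewrite /B -/x (_ : s2 mu Y q n w - sig = (s2 mu Y q n w - x) + ((x - m) +
     ((m - lrv P Y Q.+1) + (lrv P Y Q.+1 - sig)))); last by ring.
  apply: le_trans (ler_normD _ _) _; rewrite lerD2l.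
  apply: le_trans (ler_normD _ _) _; rewrite [leRHS]addrA; apply: lerD => //.
  exact: ler_normD.
rewrite EED// EED; [|exact: L1Z|exact: L1_cst].
rewrite EEZ// EE_cst.
have h1 := s2_s2tilde_dist n0.
have h2 := s2tilde_mean_lrv Q n0.
have h3 : e^-1 * EE P (fun w => (s2tilde Y n Q w - m) ^+ 2) <=
    e^-1 * (4 * (K + 2 * (G * G)) * t).
  by rewrite ler_wpM2l// invr_ge0 ltW.
rewrite -/t -/Q -/m in h1 h2 h3.
move: h3; set c := 4 * (K + 2 * (G * G)) => h3.
have -> : (6 * G + c / e + 2 * G) * t = 6 * G * t + e^-1 * (c * t) + 2 * G * t by ring.
lra.
Qed.

End estimator_consistency.

(** * Convergence of second moments and consistency of s_n^2 *)

Section weak_convergence.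
Context {R : realType} {d d' : measure_display}.
Context {T : measurableType d} {T' : measurableType d'}.
Variables (P : probability T R) (Q : probability T' R).

Lemma weak_conv_D_EE (S : nat -> R -> T -> R) (Z : R -> T' -> R) f :
  weak_conv_D P S Q Z -> sk_bounded_continuous f ->
  (forall n, L1 P (fun w => f (fun t => S n t w))) ->
  L1 Q (fun w => f (fun t => Z t w)) ->
  EE P (fun w => f (fun t => S n t w)) @[n --> \oo] --> EE Q (fun w => f (fun t => Z t w)).
Proof.
move=> SZ /SZ + LS LZ; rewrite (EFin_EE LZ) (funext (fun n => EFin_EE (LS n))).
exact: fine_cvg.
Qed.

(** Where the truncation acts, x^2 > K and so x^2 <= x^4/K: bounded fourth moments make the loss
    uniformly small. *)
Lemma trunc_sqr_bounds (x K : R) : 0 < K ->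
  0 <= x ^+ 2 - Num.min (x ^+ 2) K <= x ^+ 4 / K.
Proof.
move=> K0; have x2 := sqr_ge0 x.
have x4 : x ^+ 4 = x ^+ 2 * x ^+ 2 by rewrite -exprD.
have [h|h] := leP (x ^+ 2) K.
  rewrite subrr lexx/= x4; apply: divr_ge0; [exact: mulr_ge0|exact: ltW].
rewrite subr_ge0 (ltW h)/= ler_pdivlMr// x4.
apply: (@le_trans _ _ (x ^+ 2 * K)); first by rewrite ler_pM2r// gerBl ltW.
by apply: ler_wpM2l => //; exact: ltW.
Qed.

Variables (Y : int -> T -> R) (W : R -> T' -> R) (sigma : R).
Hypothesis HY : fourth_order_stationary P Y.
Hypothesis HW : wiener_process01 Q W.
Hypothesis sigma0 : 0 < sigma.
Hypothesis clt : weak_conv_D P (partial_sum_process Y) Q (fun t w => sigma * W t w).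
Variables (G K : R).
Hypothesis HG : forall N : nat, \sum_(i < (N + N).+1) `|gamma P Y (i%:Z - N%:Z)| <= G.
Hypothesis HK : forall (h : int) (N : nat),
  \sum_(r < (N + N).+1) \sum_(s < (N + N).+1)
     `|kappa P Y h (r%:Z - N%:Z) (s%:Z - N%:Z)| <= K.

Lemma wiener1_normal : is_normal Q (W 1) 0 1.
Proof.
move=> A mA; have i1 : (1 : R) \in `[0, 1] by rewrite in_itv/= lexx ler01.
have /(_ _ mA) := HW.1.2 1%N (fun=> 1) (fun=> 1) (fun=> i1).
rewrite !big_ord1 !mul1r minxx => <-.
by under [in RHS]eq_fun do rewrite big_ord1 mul1r.
Qed.

Lemma partial_sum_process1 n w :
  partial_sum_process Y n 1 w = (Num.sqrt n%:R)^-1 * \sum_(1 <= i < n.+1) Y i%:Z w.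
Proof. by rewrite /partial_sum_process mulr1 natrK. Qed.

(** Three comparisons: sigma^2 with the truncated second moment of sigma W(1); the latter with that
    of S_n(1), by (a), since evaluation at 1 is Skorokhod continuous; the truncated with the full
    second moment of S_n(1), by the fourth-moment bound. *)
Lemma lrv_cvg : lrv P Y n @[n --> \oo] --> sigma ^+ 2.
Proof.
have L := L4_stationary HY.
pose X n w := partial_sum_process Y n 1 w.
have LX n : L4 P (X n).
  rewrite /X (funext (partial_sum_process1 n)).
  by apply: L4Z; exact: L4_sum.
pose C := K + 3 * (G * G).
have C0 : 0 <= C by rewrite addr_ge0 ?(K_ge0 HK)// !mulr_ge0// (G_ge0 HG).
have EX2 n : (0 < n)%N -> EE P (fun w => X n w ^+ 2) = lrv P Y n.
  move=> n0; under eq_EE do rewrite /X partial_sum_process1 exprMn exprVn sqr_sqrtr//.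
  rewrite EEZ; last by apply: L1_sqr; exact: L4_sum.
  by rewrite (EE_sqr_partial_sum HY n0) mulKf// pnatr_eq0 -lt0n.
have EX4 n : (0 < n)%N -> EE P (fun w => X n w ^+ 4) <= C.
  move=> n0; have nn : n%:R != 0 :> R by rewrite pnatr_eq0 -lt0n.
  under eq_EE do rewrite /X partial_sum_process1 exprMn exprVn (exprM _ 2 2) sqr_sqrtr//.
  rewrite EEZ; last by have [] := L4_sum (index_iota 1 n.+1) (fun i : nat => L i%:Z).
  have := EE_pow4_sum_le HY HG HK (iota_uniq 1 _ : uniq (index_iota 1 n.+1)).
  rewrite size_index_iota1 -/C => h.
  rewrite mulrC ler_pdivrMr ?exprn_gt0 ?ltr0n// mulrC; exact: h.
have s2 : 0 < sigma ^+ 2 by rewrite exprn_gt0.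
have mW : measurable_fun setT (W 1) by exact: HW.1.1.
have ctr (k : R) : continuous (fun r : R => Num.min (r ^+ 2) k).
  have h : continuous (fun r : R => r ^+ 2) by exact: exprn_continuous.
  by move=> x; exact: (@min_fun_continuous _ _ _ _ _ h (@cst_continuous _ _ k) x).
apply/cvgrPdist_lt => e e0.
have e3 : 0 < e / 3 by rewrite divr_gt0.
have := std_normal_trunc_moment mW wiener1_normal.
move=> /cvgrPdist_lt/(_ (e / 3 / sigma ^+ 2)); rewrite divr_gt0// => /(_ isT) [k0 _ Hk].
(* Large enough both for the Gaussian tail and for C / (sigma^2 k) < e / 3. *)
pose k := maxn k0 (Num.truncn (C / (e / 3) / sigma ^+ 2)).+1.
have kk : 0 < k%:R :> R by rewrite ltr0n /k leq_max orbT.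
(* At level sigma^2 k, truncating (sigma W(1))^2 amounts to sigma^2 times truncating W(1)^2 at k. *)
pose kap := sigma ^+ 2 * k%:R; have kap0 : 0 < kap by exact: mulr_gt0.
have Ck : C / kap < e / 3.
  have h : C / (e / 3) / sigma ^+ 2 < k%:R.
    by apply: lt_le_trans (truncnS_gt _) _; rewrite ler_nat /k leq_max leqnn orbT.
  rewrite ltr_pdivrMr// ltr_pdivrMr// in h.
  by rewrite ltr_pdivrMr// /kap mulrC [sigma ^+ 2 * _]mulrC.
have minb (x : R) : `|Num.min (x ^+ 2) kap| <= kap.
  by rewrite ger0_norm ?ge_min ?lexx ?orbT// le_min sqr_ge0 ltW.
have LM d0 (T0 : measurableType d0) (P0 : probability T0 R) (Z : T0 -> R) :
    measurable_fun setT Z -> L1 P0 (fun w => Num.min (Z w ^+ 2) kap).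
  move=> mZ; apply: (@L1_bounded _ _ _ _ _ kap) => //.
  by apply: measurable_minr => //; exact: measurable_funX.
have cv : EE P (fun w => Num.min (X n w ^+ 2) kap) @[n --> \oo] -->
    EE Q (fun w => Num.min ((sigma * W 1 w) ^+ 2) kap).
  apply: (weak_conv_D_EE (f := fun x => Num.min (x 1 ^+ 2) kap) clt).
  - exact: (sk_bounded_continuous_eval1 (ctr kap) (ex_intro _ kap minb)).
  - by move=> n; apply: LM; case: (LX n).
  - by apply: LM; exact: measurable_funM.
have EQ : EE Q (fun w => Num.min ((sigma * W 1 w) ^+ 2) kap) =
    sigma ^+ 2 * EE Q (fun w => Num.min (W 1 w ^+ 2) k%:R).
  rewrite -EEZ; last first.
    apply: (@L1_bounded _ _ _ _ _ k%:R).
      by apply: measurable_minr => //; exact: measurable_funX.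
    by move=> w; rewrite ger0_norm ?ge_min ?lexx ?orbT// le_min sqr_ge0/=.
  by apply: eq_EE => w; rewrite exprMn minr_pMr// ltW.
have h1 : `|sigma ^+ 2 - EE Q (fun w => Num.min ((sigma * W 1 w) ^+ 2) kap)| < e / 3.
  rewrite EQ -[X in `|X - _|]mulr1 -mulrBr normrM gtr0_norm// mulrC -ltr_pdivlMr//.
  by apply: Hk; rewrite /= leq_maxl.
have := cv => /cvgrPdist_lt/(_ _ e3)[n0 _ Hn].
exists (maxn n0 1) => // n /=; rewrite geq_max => /andP[nn0 n1].
have h2 := Hn n nn0.
have h3 : `|EE P (fun w => Num.min (X n w ^+ 2) kap) - lrv P Y n| < e / 3.
  rewrite -EX2// distrC -EEB; [|exact: L1_sqr|by apply: LM; case: (LX n)].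
  have b w := trunc_sqr_bounds (X n w) kap0.
  rewrite ger0_norm; last by apply: EE_ge0 => w; case/andP: (b w).
  apply: le_lt_trans Ck; apply: (@le_trans _ _ (EE P (fun w => X n w ^+ 4 / kap))).
    apply: EE_le => [||w]; last by case/andP: (b w).
    - by apply: L1B; [exact: L1_sqr|apply: LM; case: (LX n)].
    - by apply: L1Zr; case: (LX n).
  rewrite EEZr; last by case: (LX n).
  by rewrite ler_wpM2r ?EX4// invr_ge0 ltW.
rewrite (_ : sigma ^+ 2 - lrv P Y n =
  (sigma ^+ 2 - EE Q (fun w => Num.min ((sigma * W 1 w) ^+ 2) kap)) +
  ((EE Q (fun w => Num.min ((sigma * W 1 w) ^+ 2) kap) -
    EE P (fun w => Num.min (X n w ^+ 2) kap)) +
  (EE P (fun w => Num.min (X n w ^+ 2) kap) - lrv P Y n))); last by ring.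
apply: le_lt_trans (ler_normD _ _) _.
apply: (@lt_le_trans _ _ (e / 3 + (e / 3 + e / 3))); last by lra.
apply: ltrD => //; apply: le_lt_trans (ler_normD _ _) _; exact: ltrD.
Qed.

Variables (mu : R) (q : nat -> nat).
Hypothesis q_oo : forall M : nat, \forall n \near \oo, (M <= q n)%N.
Hypothesis q_small : (fun n : nat => (q n)%:R / n%:R : R) @ \oo --> 0.

(** [q_oo] transfers the limit of v_N to v_(q+1), and [q_small] removes the terms of order q/n;
    passing from q to q + 1 costs 1/n. *)
Lemma s2_cvg : EE P (fun w => `|s2 mu Y q n w - sigma ^+ 2|) @[n --> \oo] --> 0.
Proof.
have qn : (q n).+1%:R / n%:R @[n --> \oo] --> (0 : R).
  rewrite -[X in _ --> X]addr0.
  under eq_fun do rewrite -addn1 natrD mulrDl mul1r.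
  apply: cvgD; first exact: q_small.
  rewrite -(cvg_shiftS (fun n : nat => n%:R^-1 : R)); exact: cvg_harmonic.
have lq : lrv P Y (q n).+1 @[n --> \oo] --> sigma ^+ 2.
  apply/cvgrPdist_lt => e e0.
  have /cvgrPdist_lt/(_ _ e0)[N _ HN] := lrv_cvg.
  have [n0 _ H0] := q_oo N; exists n0 => // n /H0 Nq; apply: HN => /=.
  exact: leq_trans Nq (leqnSn _).
apply/cvgrPdist_lt => e e0.
have e3 : 0 < e / 3 by rewrite divr_gt0.
pose c := 8 * G + 4 * (K + 2 * (G * G)) / (e / 3).
have cq : c * ((q n).+1%:R / n%:R) @[n --> \oo] --> (0 : R).
  by rewrite -[X in _ --> X](mulr0 c); exact: cvgMl_tmp.
have /cvgrPdist_lt/(_ _ e3)[n1 _ H1] := cq.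
have /cvgrPdist_lt/(_ _ e3)[n2 _ H2] := lq.
exists (maxn 1 (maxn n1 n2)) => // n /=; rewrite !geq_max => /and3P[n0 m1 m2].
have := s2_dist HY HG HK mu q (sigma ^+ 2) n0 e3; rewrite -/c => h.
have := H1 n m1; have := H2 n m2; rewrite /= !sub0r !normrN distrC => h2 h1.
rewrite ger0_norm; last exact: EE_ge0.
apply: le_lt_trans h _; have := ler_norm (c * ((q n).+1%:R / n%:R)).
move: h1 h2; set x := c * _; set y := `|lrv P Y (q n).+1 - _|; lra.
Qed.

End weak_convergence.

(** * Continuity of studentization, uniformly on compacts *)

Section studentization.
Context {R : realType}.

(* [x / (x^2 + 1/n)] also converges at 0, to the junk value 0^-1 = 0. *)
Lemma measurable_inv : measurable_fun setT (fun x : R => x^-1).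
Proof.
have mf (n : nat) : measurable_fun setT (fun x : R => x * (x * x + n.+1%:R^-1)^-1).
  apply: continuous_measurable_fun => x; apply: cvgM; first exact: cvg_id.
  have p : 0 < x * x + n.+1%:R^-1.
    by rewrite ltr_wpDl ?invr_gt0// -expr2 sqr_ge0.
  apply: (cvgV (f := fun x : R => x * x + n.+1%:R^-1)); first by rewrite gt_eqF.
  by apply: cvgD; [apply: cvgM; exact: cvg_id|exact: cvg_cst].
apply: (measurable_fun_cvg mf) => x _.
have [->|x0] := eqVneq x 0.
  by rewrite invr0; apply: cvg_near_cst; apply: nearW => n; rewrite mul0r.
rewrite (_ : x^-1 = x * (x * x + 0)^-1); last by field.
apply: cvgMl_tmp; apply: (cvgV (f := fun n : nat => x * x + n.+1%:R^-1)).
  by rewrite addr0 mulf_neq0.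
by apply: cvgD; [exact: cvg_cst|exact: cvg_harmonic].
Qed.

(** The variables are [u], the error [a - u] and the variance estimate [v]; in these coordinates the
    base point (0, s) of the last two does not move with [u], as the compactness argument
    requires. *)
Lemma studentized_continuous (g : R -> R) (u s : R) : 0 < s -> continuous g ->
  (fun z : R * (R * R) =>
     g ((Num.sqrt z.2.2)^-1 * (z.1 + z.2.1)) - g (z.1 / Num.sqrt s))
  z @[z --> ((u, (0, s)) : R * (R * R))] --> (0 : R).
Proof.
move=> s0 cg.
have c1 : (fun z : R * (R * R) => z.1) z @[z --> ((u, (0, s)) : R * (R * R))] --> u.
  exact: cvg_fst.
have c2 : (fun z : R * (R * R) => z.2) z @[z --> ((u, (0, s)) : R * (R * R))]
    --> ((0, s) : R * R) by exact: cvg_snd.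
have c21 : (fun z : R * (R * R) => z.2.1) z @[z --> ((u, (0, s)) : R * (R * R))]
    --> (0 : R) by apply: cvg_comp c2 _; exact: cvg_fst.
have c22 : (fun z : R * (R * R) => z.2.2) z @[z --> ((u, (0, s)) : R * (R * R))]
    --> s by apply: cvg_comp c2 _; exact: cvg_snd.
have c3 : (Num.sqrt z.2.2)^-1 * (z.1 + z.2.1)
    @[z --> ((u, (0, s)) : R * (R * R))] --> (Num.sqrt s)^-1 * (u + 0).
  apply: cvgM; last by apply: cvgD; [exact: c1|exact: c21].
  apply: (cvgV (f := fun z : R * (R * R) => Num.sqrt z.2.2)).
    by rewrite gt_eqF// sqrtr_gt0.
  by apply: (@continuous_cvg _ _ _ _ _ _ Num.sqrt _ _ c22); exact: sqrt_continuous.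
have c4 : z.1 / Num.sqrt s @[z --> ((u, (0, s)) : R * (R * R))] --> u / Num.sqrt s.
  by apply: cvgMr_tmp; exact: c1.
have c5 := cvg_comp _ g c3 (cg _).
have c6 := cvg_comp _ g c4 (cg _).
have e0 : g ((Num.sqrt s)^-1 * (u + 0)) - g (u / Num.sqrt s) = 0.
  by rewrite addr0 mulrC subrr.
by rewrite -[X in _ --> X]e0; exact: cvgB c5 c6.
Qed.

(** A tube lemma: continuity at each point of [0, K] x {(0, s)} yields one neighbourhood of (0, s)
    valid for all [u]. *)
Lemma studentized_uniform (g : R -> R) (s K e : R) : 0 < s -> continuous g -> 0 < e ->
  exists2 delta, 0 < delta & forall u a v, 0 <= u <= K ->
    `|a - u| < delta -> `|v - s| < delta ->
    `|g ((Num.sqrt v)^-1 * a) - g (u / Num.sqrt s)| < e.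
Proof.
move=> s0 cg e0.
pose Pr (i : R * R) (u : R) :=
  `|g ((Num.sqrt i.2)^-1 * (u + i.1)) - g (u / Num.sqrt s)| < e.
have /compact_near_coveringP nc := @segment_compact R 0 K.
have := nc (R * R)%type (nbhs ((0, s) : R * R)) Pr _ _.
case.
  move=> u _; have /cvgrPdist_lt/(_ _ e0) := studentized_continuous u s0 cg.
  by apply: filterS => -[x' i] /=; rewrite sub0r normrN.
move=> [A B] /= [[d1 /= d10 D1] [d2 /= d20 D2]] AB.
exists (Num.min d1 d2); first by rewrite lt_min d10.
move=> u a v uK; rewrite !lt_min => /andP[au _] /andP[_ vs].
have : Pr (a - u, v) u.
  apply: AB; last by rewrite /= in_itv.
  by split; [apply: D1|apply: D2]; rewrite /ball_/= ?sub0r ?normrN// distrC.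
by rewrite /Pr/= [u + _]addrC subrK.
Qed.

(** A continuous substitute for the indicator of u > K, rising from 0 at K to 1 at K + 1, so that
    convergence in law applies to it. *)
Definition tail_cutoff (K u : R) : R := Num.min 1 (Num.max 0 (u - K)).

Lemma tail_cutoff_itv K u : 0 <= tail_cutoff K u <= 1.
Proof. by rewrite /tail_cutoff le_min ler01 le_max lexx/= ge_min lexx. Qed.

Lemma tail_cutoff_continuous K : continuous (tail_cutoff K).
Proof.
have h : continuous (fun u : R => u - K).
  by move=> u; apply: cvgB; [exact: cvg_id|exact: cvg_cst].
have h2 := @max_fun_continuous _ _ _ _ _ (@cst_continuous _ _ (0 : R)) h.
by move=> u; exact: (@min_fun_continuous _ _ _ _ _ (@cst_continuous _ _ (1 : R)) h2 u).
Qed.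

Lemma tail_cutoff_measurable K : measurable_fun setT (tail_cutoff K).
Proof. by apply: continuous_measurable_fun; exact: tail_cutoff_continuous. Qed.

Lemma tail_cutoff_gt K u : K + 1 < u -> tail_cutoff K u = 1.
Proof. by move=> h; rewrite /tail_cutoff min_l// le_max lerBrDl (ltW h) orbT. Qed.

Lemma tail_cutoff_le K u : u <= K -> tail_cutoff K u = 0.
Proof. by move=> h; rewrite /tail_cutoff max_l ?subr_le0// min_r// ler01. Qed.

Lemma studentized_dist (g : R -> R) (M s K e delta u a v : R) :
  0 < s -> (forall r, `|g r| <= M) -> 0 < delta -> 0 < e -> 0 <= u ->
  (forall u a v, 0 <= u <= K + 1 -> `|a - u| < delta -> `|v - s| < delta ->
    `|g ((Num.sqrt v)^-1 * a) - g (u / Num.sqrt s)| < e) ->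
  `|g ((Num.sqrt v)^-1 * a) - g (u / Num.sqrt s)| <=
  e + 2 * M / delta * (`|a - u| + `|v - s|) + 2 * M * tail_cutoff K u.
Proof.
move=> s0 gM d0 e0 u0 H.
have M0 : 0 <= M by apply: le_trans (gM 0).
have c0 : 0 <= 2 * M / delta by rewrite divr_ge0 ?mulr_ge0// ltW.
have /andP[t0 _] := tail_cutoff_itv K u.
have b : `|g ((Num.sqrt v)^-1 * a) - g (u / Num.sqrt s)| <= 2 * M.
  by rewrite mulr2n mulrDl mul1r (le_trans (ler_normB _ _))// lerD.
have p1 : 0 <= 2 * M / delta * (`|a - u| + `|v - s|) by rewrite mulr_ge0.
have p2 : 0 <= 2 * M * tail_cutoff K u by rewrite !mulr_ge0.
have big : delta <= `|a - u| + `|v - s| ->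
    2 * M <= 2 * M / delta * (`|a - u| + `|v - s|).
  move=> h; rewrite -{1}[2 * M](divfK (_ : delta != 0)) ?gt_eqF//.
  by rewrite ler_wpM2l.
have [uK|uK] := leP u (K + 1); last first.
  by move: p2 b; rewrite tail_cutoff_gt// mulr1; lra.
have [h|h] := ltP `|a - u| delta; last first.
  have := big (le_trans h _); rewrite lerDl normr_ge0 => /(_ isT); lra.
have [h'|h'] := ltP `|v - s| delta; last first.
  have := big (le_trans h' _); rewrite lerDr normr_ge0 => /(_ isT); lra.
by have := H u a v; rewrite u0 uK => /(_ isT h h'); lra.
Qed.

End studentization.

(** * The CUSUM functional and its continuous-time version *)

Section cusum.
Context {R : realType} {d : measure_display} {T : measurableType d}.
Variables (P : probability T R) (Y : int -> T -> R) (mu : R) (q : nat -> nat).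
Hypothesis mY : forall k, measurable_fun setT (Y k).

Let S k w : R := \sum_(1 <= i < k.+1) Y i%:Z w.
Let X n t w : R := partial_sum_process Y n t w.

Definition cusum n w : R := (Num.sqrt n%:R)^-1 *
  \big[Num.max/0]_(1 <= k < n.+1) `|S k w - k%:R / n%:R * S n w|.

Definition cusum_sup n w : R := sup01 (bridge (fun t => X n t w)).

(** The mean drops out: it contributes k mu - (k/n) n mu = 0 to each term. *)
Lemma TnE n w : (0 < n)%N ->
  Tn mu Y q n w = (Num.sqrt (s2 mu Y q n w))^-1 * cusum n w.
Proof.
move=> n0; have nn : n%:R != 0 :> R by rewrite pnatr_eq0 -lt0n.
rewrite /Tn /cusum invfM mulrA [_^-1 * _^-1]mulrC; congr (_ * _).
apply: eq_bigr => k _; rewrite /Xs !big_split/= !sumr_const_nat !subn1/=.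
by congr `|_|; rewrite -[mu *+ k]mulr_natr -[mu *+ n]mulr_natr /S; field.
Qed.

Lemma partial_sum_step n k t w : n%:R * t = k%:R :> R ->
  X n t w = (Num.sqrt n%:R)^-1 * S k w.
Proof. by move=> h; rewrite /X /partial_sum_process h natrK. Qed.

Lemma truncn_le1 n (t : R) : 0 <= t <= 1 -> (Num.truncn (n%:R * t) <= n)%N.
Proof.
move=> /andP[t0 t1]; rewrite -(ler_nat R).
have nt0 : 0 <= n%:R * t by rewrite mulr_ge0.
have /andP[h _] := truncn_itv nt0.
by apply: le_trans h _; rewrite ler_piMr.
Qed.

Lemma partial_sum_ub n w : ub01 (fun t => `|X n t w|).
Proof.
exists ((Num.sqrt n%:R)^-1 * \sum_(1 <= i < n.+1) `|Y i%:Z w|) => t t01.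
rewrite /X /partial_sum_process normrM ger0_norm ?invr_ge0 ?sqrtr_ge0//.
rewrite ler_wpM2l ?invr_ge0 ?sqrtr_ge0//; apply: le_trans (ler_norm_sum _ _ _) _.
apply: ler_sum_uniq_sub; rewrite ?iota_uniq// => i.
by rewrite !mem_index_iota; have := truncn_le1 n t01; lia.
Qed.

Lemma partial_sum_rcont n w : rcont01 (fun t => X n t w).
Proof.
move=> t /andP[t0 t1]; apply: cvg_near_cst; rewrite /X /partial_sum_process.
case: n => [|n]; first by near=> s; rewrite !mul0r.
have nn : 0 < n.+1%:R :> R by rewrite ltr0n.
have nt0 : 0 <= n.+1%:R * t by rewrite mulr_ge0.
have /andP[h1 h2] := truncn_itv nt0.
have ts : t < (Num.truncn (n.+1%:R * t)).+1%:R / n.+1%:R.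
  by rewrite ltr_pdivlMr// mulrC.
near=> s.
have st : t < s by near: s; exact: nbhs_right_gt.
have sk : s < (Num.truncn (n.+1%:R * t)).+1%:R / n.+1%:R.
  by near: s; exact: nbhs_right_lt.
congr (_ * \sum_(1 <= i < _.+1) _); apply: truncn_def.
rewrite (le_trans h1) ?ler_pM2l ?(ltW st)//=.
by move: sk; rewrite ltr_pdivlMr// mulrC.
Unshelve. all: by end_near. Qed.

Lemma cusum_sup_measurable n : measurable_fun setT (cusum_sup n).
Proof.
apply: (measurable_sup01 (F := fun t w => bridge (fun s => X n s w) t)) => [t|w|w].
- have mX t' : measurable_fun setT (X n t').
    by apply: measurable_funM => //; exact: measurable_sum.
  apply: (measurableT_comp (@normr_measurable R setT)); apply: measurable_funB => //.
  exact: measurable_funM.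
- by apply: ub01_bridge; exact: partial_sum_ub.
- by apply: rcont01_bridge; exact: partial_sum_rcont.
Qed.

Lemma cusum_measurable n : measurable_fun setT (cusum n).
Proof.
have mS k : measurable_fun setT (S k) by exact: measurable_sum.
apply: measurable_funM => //.
elim: (index_iota 1 n.+1) => [|k r IH].
  by under eq_fun do rewrite big_nil; exact: measurable_cst.
under eq_fun do rewrite big_cons.
apply: measurable_maxr => //.
apply: (measurableT_comp (@normr_measurable R setT)); apply: measurable_funB => //.
exact: measurable_funM.
Qed.

Lemma cusum_sup_ge0 n w : 0 <= cusum_sup n w.
Proof.
have i0 : 0 <= (0 : R) <= 1 by rewrite lexx ler01.
have := sup01_ub (ub01_bridge (partial_sum_ub n w)) i0.
by apply: le_trans; exact: normr_ge0.
Qed.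

(** The points k/n are among the times of the supremum. Conversely, between two of them S_n is
    constant and only the drift t S_n(1) moves, by at most |S_n(1)|/n. *)
Lemma cusum_dist n w : (0 < n)%N ->
  `|cusum n w - cusum_sup n w| <= `|X n 1 w| / n%:R.
Proof.
move=> n0; have nn : 0 < n%:R :> R by rewrite ltr0n.
have sq0 : 0 <= (Num.sqrt n%:R)^-1 :> R by rewrite invr_ge0 sqrtr_ge0.
have X1 : X n 1 w = (Num.sqrt n%:R)^-1 * S n w.
  by apply: partial_sum_step; rewrite mulr1.
have step k : bridge (fun t => X n t w) (k%:R / n%:R) =
    (Num.sqrt n%:R)^-1 * `|S k w - k%:R / n%:R * S n w|.
  rewrite /bridge X1 (partial_sum_step (k := k)); last first.
    by rewrite mulrC divfK// gt_eqF.
  by rewrite mulrCA -mulrBr normrM (ger0_norm sq0).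
have le1 : cusum n w <= cusum_sup n w.
  rewrite /cusum big_seq; elim/big_ind: _ => [|x y hx hy|k].
  - by rewrite mulr0; exact: cusum_sup_ge0.
  - by rewrite maxr_pMr// ge_max hx hy.
  rewrite mem_index_iota => /andP[k1 kn]; rewrite -step; apply: sup01_ub.
    by apply: ub01_bridge; exact: partial_sum_ub.
  by rewrite divr_ge0//= ler_pdivrMr// mul1r ler_nat -ltnS.
have le2 : cusum_sup n w <= cusum n w + `|X n 1 w| / n%:R.
  apply: sup01_le => t t01; have /andP[t0 t1] := t01.
  pose k := Num.truncn (n%:R * t).
  have kn : (k <= n)%N := truncn_le1 n t01.
  have /andP[k1 k2] : k%:R <= n%:R * t < k.+1%:R.
    by apply: truncn_itv; rewrite mulr_ge0.
  have Xk : X n t w = X n (k%:R / n%:R) w.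
    rewrite [RHS](partial_sum_step (k := k)) ?/X//.
    by rewrite mulrC divfK// gt_eqF.
  have tk : `|k%:R / n%:R - t| <= n%:R^-1.
    rewrite distrC ger0_norm; last by rewrite subr_ge0 ler_pdivrMr// mulrC.
    rewrite lerBlDr -[X in X + _]mul1r -mulrDl ler_pdivlMr// mulrC addrC natr1.
    exact: ltW.
  have bk : bridge (fun t => X n t w) (k%:R / n%:R) <= cusum n w.
    rewrite step /cusum ler_wpM2l//.
    (* The index 0 is absent from the maximum, but its term is 0 and the maximum starts from 0. *)
    case: k kn {k1 k2 Xk tk} => [|k] kn.
      rewrite /S big_geq// !mul0r subrr normr0.
      elim: (index_iota 1 n.+1) => [|i r IH]; first by rewrite big_nil.
      by rewrite big_cons le_max normr_ge0.
    apply: (le_bigmax_seq 0 k.+1 xpredT (fun k => `|S k w - k%:R / n%:R * S n w|)) => //.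
    by rewrite mem_index_iota.
  apply: le_trans (lerD bk (lexx _)); rewrite /bridge Xk.
  rewrite (_ : X n (k%:R / n%:R) w - t * X n 1 w =
     (X n (k%:R / n%:R) w - k%:R / n%:R * X n 1 w) +
     (k%:R / n%:R - t) * X n 1 w); last by ring.
  apply: le_trans (ler_normD _ _) _; rewrite lerD2l normrM mulrC ler_wpM2l//.
by rewrite distrC ger0_norm ?subr_ge0// lerBlDl.
Qed.

End cusum.

(** * Convergence in law of T_n *)

Section limit_law.
Context {R : realType}.

Lemma sup01_scale (c : R) (f : R -> R) : 0 < c -> ub01 f ->
  sup01 (fun t => c * f t) = c * sup01 f.
Proof.
move=> c0 fM; apply/eqP; rewrite eq_le; apply/andP; split.
  by apply: sup01_le => t t01; rewrite ler_pM2l//; exact: sup01_ub.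
have cM : ub01 (fun t => c * f t).
  by case: fM => M fM; exists (c * M) => t t01; rewrite ler_pM2l//; exact: fM.
rewrite -ler_pdivlMl//; apply: sup01_le => t t01; rewrite ler_pdivlMl//.
exact: (sup01_ub cM t01).
Qed.

Context {d d' d'' : measure_display}.
Context {T : measurableType d} {T' : measurableType d'} {T'' : measurableType d''}.
Variables (P : probability T R) (Q : probability T' R) (Q'' : probability T'' R).
Variables (Y : int -> T -> R) (W : R -> T' -> R) (B : R -> T'' -> R) (sigma : R).
Hypothesis HY : fourth_order_stationary P Y.
Hypothesis HW : wiener_process01 Q W.
Hypothesis HB : brownian_bridge01 Q'' B.
Hypothesis sigma0 : 0 < sigma.
Hypothesis clt : weak_conv_D P (partial_sum_process Y) Q (fun t w => sigma * W t w).
Variables (G K : R).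
Hypothesis HG : forall N : nat, \sum_(i < (N + N).+1) `|gamma P Y (i%:Z - N%:Z)| <= G.
Hypothesis HK : forall (h : int) (N : nat),
  \sum_(r < (N + N).+1) \sum_(s < (N + N).+1)
     `|kappa P Y h (r%:Z - N%:Z) (s%:Z - N%:Z)| <= K.
Variables (mu : R) (q : nat -> nat).
Hypothesis q_oo : forall M : nat, \forall n \near \oo, (M <= q n)%N.
Hypothesis q_small : (fun n : nat => (q n)%:R / n%:R : R) @ \oo --> 0.

Let mY : forall k, measurable_fun setT (Y k) := HY.1.
Let V w : R := sup01 (fun t => `|B t w|).
Let U n w : R := cusum_sup Y n w.

Lemma scaled_wiener_sup w :
  sup01 (bridge (fun t => sigma * W t w)) = sigma * sup01 (bridge (W^~ w)).
Proof.
rewrite -(sup01_scale sigma0 (ub01_bridge (wiener_ub HW w))).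
congr sup01; apply/funext => t; rewrite /bridge mulrCA -mulrBr normrM.
by rewrite (ger0_norm (ltW sigma0)).
Qed.

(** Weak convergence gives the limit on the space carrying W; [wiener_bridge_sup_law] moves it to
    the unrelated space carrying B. *)
Lemma cusum_sup_cvg (g : R -> R) (M : R) : continuous g -> (forall r, `|g r| <= M) ->
  EE P (fun w => g (U n w)) @[n --> \oo] --> EE Q'' (fun w => g (sigma * V w)).
Proof.
move=> cg gM.
have mg : measurable_fun setT g by exact: continuous_measurable_fun.
have mV : measurable_fun setT V by exact: bridge_sup_measurable HB.
have mh : measurable_fun setT (fun r => g (sigma * r)).
  by apply: measurableT_comp => //; exact: measurable_funM.
have -> : EE Q'' (fun w => g (sigma * V w)) =
    EE Q (fun w => g (sup01 (bridge (fun t => sigma * W t w)))).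
  rewrite -(@wiener_bridge_sup_law _ _ _ _ _ Q Q'' W B HW HB (fun r => g (sigma * r)) M)//.
  by apply: eq_EE => w; rewrite scaled_wiener_sup.
apply: (weak_conv_D_EE (f := fun x => g (sup01 (bridge x))) clt).
- by apply: sk_bounded_continuous_bridge_sup => //; exists M.
- move=> n; apply: (@L1_bounded _ _ _ _ _ M) => //.
  by apply: measurableT_comp => //; exact: (cusum_sup_measurable mY n).
- apply: (@L1_bounded _ _ _ _ _ M) => //.
  under eq_fun do rewrite scaled_wiener_sup.
  apply: measurableT_comp => //; apply: measurable_funM => //.
  exact: wiener_bridge_sup_measurable HW.
Qed.

(** From |x| <= 1 + x^2; it makes the error of [cusum_dist] O(1/n) in mean. *)
Lemma EE_norm_partial_sum1 n : (0 < n)%N ->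
  L1 P (fun w => `|partial_sum_process Y n 1 w|) /\
  EE P (fun w => `|partial_sum_process Y n 1 w|) <= 1 + G.
Proof.
move=> n0; have L := L4_stationary HY.
have LX : L4 P (partial_sum_process Y n 1).
  by rewrite (funext (partial_sum_process1 Y n)); apply: L4Z; exact: L4_sum.
split; first by apply: L1_abs; exact: L4_L1.
apply: (@le_trans _ _ (EE P (fun w => 1 + partial_sum_process Y n 1 w ^+ 2))).
  apply: EE_le => [||w].
  - by apply: L1_abs; exact: L4_L1.
  - by apply: L1D; [exact: L1_cst|exact: L1_sqr].
  set x := partial_sum_process _ _ _ _; rewrite -(real_normK (num_real x)).
  by have := sqr_ge0 (`|x| - 1); nra.
rewrite EED; [|exact: L1_cst|exact: L1_sqr]; rewrite EE_cst lerD2l.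
under eq_EE do rewrite partial_sum_process1 exprMn exprVn sqr_sqrtr//.
rewrite EEZ; last by apply: L1_sqr; exact: L4_sum.
rewrite mulrC ler_pdivrMr ?ltr0n// mulrC.
have := EE_sqr_sum_le HY HG (iota_uniq 1 _ : uniq (index_iota 1 n.+1)).
by rewrite size_index_iota1.
Qed.

Lemma Tn_measurable n : (0 < n)%N -> measurable_fun setT (Tn mu Y q n).
Proof.
move=> n0; rewrite (funext (fun w => TnE Y mu q w n0)).
apply: measurable_funM; last exact: cusum_measurable.
apply: (measurableT_comp measurable_inv).
have msqrt : measurable_fun setT (@Num.sqrt R).
  by apply: continuous_measurable_fun; exact: sqrt_continuous.
apply: (measurableT_comp msqrt).
exact: L1_measurable (L1_s2 HY mu q n0).
Qed.

(** The budget is five times e/5: uniform continuity on a compact, the L^1 remainder, the tail of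
    the limit, the passage of that tail to finite n, and the convergence of the numerator divided by
    sigma. *)
Lemma Tn_EE_cvg (g : R -> R) (M : R) : continuous g -> (forall r, `|g r| <= M) ->
  EE P (fun w => g (Tn mu Y q n w)) @[n --> \oo] --> EE Q'' (fun w => g (V w)).
Proof.
move=> cg gM.
have M0 : 0 <= M by apply: le_trans (gM 0).
have mg : measurable_fun setT g by exact: continuous_measurable_fun.
have sg2 : 0 < sigma ^+ 2 by rewrite exprn_gt0.
have sE : Num.sqrt (sigma ^+ 2) = sigma by rewrite sqrtr_sqr gtr0_norm.
have mV : measurable_fun setT V by exact: bridge_sup_measurable HB.
have mU n : measurable_fun setT (U n) by exact: cusum_sup_measurable.
have cgs : continuous (fun r : R => g (r / sigma)).
  move=> r; apply: (continuous_comp (f := fun r : R => r / sigma) (g := g)); last exact: cg.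
  by apply: cvgMr_tmp; exact: cvg_id.
have main : EE P (fun w => g (U n w / sigma)) @[n --> \oo] --> EE Q'' (fun w => g (V w)).
  have := cusum_sup_cvg cgs (fun r => gM (r / sigma)).
  rewrite [in X in _ --> X](_ : EE Q'' _ = EE Q'' (fun w => g (V w)))//.
  by apply: eq_EE => w; rewrite mulrC mulKf// gt_eqF.
(* The limit law is tight. *)
have tc0 : EE Q'' (fun w => tail_cutoff k%:R (sigma * V w)) @[k --> \oo] --> (0 : R).
  rewrite -[X in _ --> X](EE_cst Q'').
  apply: (@EE_bounded_cvg _ _ _ Q'' _ (fun=> 0) 1) => [k|k w|w].
  - apply: measurableT_comp; first exact: tail_cutoff_measurable.
    exact: measurable_funM.
  - by have /andP[h0 h1] := tail_cutoff_itv k%:R (sigma * V w); rewrite ger0_norm.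
  - apply: cvg_near_cst; exists (Num.truncn (sigma * V w)).+1 => // k /= h.
    apply: tail_cutoff_le; apply: ltW; apply: lt_le_trans (truncnS_gt _) _.
    by rewrite ler_nat.
apply/cvgrPdist_lt => e e0.
have e5 : 0 < e / 5 by rewrite divr_gt0.
(* The compact [0, k + 1] is fixed from the limit law before [delta], which depends on it. *)
have [k k1] : exists k : nat,
    2 * M * EE Q'' (fun w => tail_cutoff k%:R (sigma * V w)) < e / 5.
  have c2 : 2 * M * EE Q'' (fun w => tail_cutoff k%:R (sigma * V w))
      @[k --> \oo] --> (0 : R).
    by rewrite -[X in _ --> X](mulr0 (2 * M)); exact: cvgMl_tmp.
  have /cvgrPdist_lt/(_ _ e5)[k _ Hk] := c2.
  exists k; have := Hk k (leqnn k); rewrite /= sub0r normrN.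
  exact: le_lt_trans (ler_norm _).
have [delta d0 Hd] := studentized_uniform (k%:R + 1) sg2 cg e5.
have tcU : 2 * M * EE P (fun w => tail_cutoff k%:R (U n w)) @[n --> \oo] -->
    2 * M * EE Q'' (fun w => tail_cutoff k%:R (sigma * V w)).
  apply: cvgMl_tmp; apply: (cusum_sup_cvg (M := 1)); first exact: tail_cutoff_continuous.
  by move=> r; have /andP[h0 h1] := tail_cutoff_itv k%:R r; rewrite ger0_norm.
have s2c := s2_cvg HY HW sigma0 clt HG HK mu q_oo q_small.
have rem0 : (1 + G) / n%:R + EE P (fun w => `|s2 mu Y q n w - sigma ^+ 2|)
    @[n --> \oo] --> (0 : R).
  rewrite -[X in _ --> X]addr0; apply: cvgD; last exact: s2c.
  rewrite -[X in _ --> X](mulr0 (1 + G)); apply: cvgMl_tmp.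
  rewrite -(cvg_shiftS (fun n : nat => n%:R^-1 : R)); exact: cvg_harmonic.
have rem : 2 * M / delta * ((1 + G) / n%:R +
    EE P (fun w => `|s2 mu Y q n w - sigma ^+ 2|)) @[n --> \oo] --> (0 : R).
  by rewrite -[X in _ --> X](mulr0 (2 * M / delta)); exact: cvgMl_tmp.
have /cvgrPdist_lt/(_ _ e5)[n1 _ H1] := tcU.
have /cvgrPdist_lt/(_ _ e5)[n2 _ H2] := rem.
have /cvgrPdist_lt/(_ _ e5)[n3 _ H3] := main.
exists (maxn 1 (maxn n1 (maxn n2 n3))) => // n /=.
rewrite !geq_max => /and4P[n0 /H1 h1 /H2 h2 /H3 h3].
have nn : 0 < n%:R :> R by rewrite ltr0n.
have [LX EX] := EE_norm_partial_sum1 n0.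
pose t w := tail_cutoff k%:R (U n w).
pose X w := `|partial_sum_process Y n 1 w|.
pose v w := `|s2 mu Y q n w - sigma ^+ 2|.
have Lv : L1 P v.
  by apply: L1_abs; apply: L1B; [exact: L1_s2|exact: L1_cst].
have Lt : L1 P t.
  apply: (@L1_bounded _ _ _ _ _ 1).
    by apply: measurableT_comp; [exact: tail_cutoff_measurable|exact: mU].
  by move=> w; have /andP[t0 t1] := tail_cutoff_itv k%:R (U n w); rewrite ger0_norm.
have L1g Z : measurable_fun setT Z -> L1 P (fun w => g (Z w)).
  by move=> mZ; apply: (@L1_bounded _ _ _ _ _ M) => //; exact: measurableT_comp.
have Lg1 := L1g _ (Tn_measurable n0).
have Lg2 : L1 P (fun w => g (U n w / sigma)) by apply: L1g; exact: measurable_funM.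
have b : `|EE P (fun w => g (Tn mu Y q n w)) - EE P (fun w => g (U n w / sigma))| <=
    e / 5 + 2 * M / delta * ((1 + G) / n%:R + EE P v) + 2 * M * EE P t.
  rewrite -EEB//; apply: le_trans (EE_abs_le (L1B Lg1 Lg2)) _.
  have LR : L1 P (fun w => X w / n%:R + v w) by apply: L1D => //; exact: L1Zr.
  apply: (@le_trans _ _ (EE P (fun w =>
      e / 5 + 2 * M / delta * (X w / n%:R + v w) + 2 * M * t w))).
    apply: EE_le => [||w].
    - by apply: L1_abs; exact: L1B.
    - by apply: L1D; [apply: L1D; [exact: L1_cst|exact: L1Z]|exact: L1Z].
    rewrite TnE//.
    have := @studentized_dist R g M (sigma ^+ 2) k%:R (e / 5) delta (U n w)
      (cusum Y n w) (s2 mu Y q n w) sg2 gM d0 e5 (cusum_sup_ge0 Y n w) Hd.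
    rewrite sE => /le_trans; apply.
    rewrite lerD2r lerD2l ler_wpM2l ?divr_ge0 ?mulr_ge0 ?(ltW d0)//.
    by rewrite lerD2r; exact: cusum_dist.
  rewrite EED; [|by apply: L1D; [exact: L1_cst|exact: L1Z]|exact: L1Z].
  rewrite EED; [|exact: L1_cst|exact: L1Z].
  rewrite EE_cst !EEZ// EED//; last exact: L1Zr.
  rewrite lerD2r lerD2l ler_wpM2l ?divr_ge0 ?mulr_ge0 ?(ltW d0)//.
  by rewrite lerD2r EEZr// ler_wpM2r ?invr_ge0// ltW.
rewrite sub0r normrN in h2.
have h2' := le_lt_trans (ler_norm _) h2.
have h1' := le_lt_trans (ler_norm _) (eq_ind _ (fun x => x < _) h1 _ (distrC _ _)).
rewrite (_ : EE Q'' _ - _ = (EE Q'' (fun w => g (V w)) - EE P (fun w => g (U n w / sigma)))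
  - (EE P (fun w => g (Tn mu Y q n w)) - EE P (fun w => g (U n w / sigma)))); last by ring.
apply: le_lt_trans (ler_normB _ _) _.
move: k1 h1' h2' h3 b; rewrite -/v -/t.
set A1 := `|_ - _|; set A2 := `|_ - _|; set A3 := 2 * M * EE Q'' _.
set A4 := 2 * M * EE P t; set A5 := 2 * M / delta * _.
lra.
Qed.

End limit_law.

Unset Implicit Arguments.
Set Strict Implicit.

Theorem theorem3p1 (R : realType) (d : measure_display) (Omega : measurableType d)
  (P : probability Omega R) (Y : int -> Omega -> R) (mu : R) (q : nat -> nat) :
  fourth_order_stationary P Y ->
  (forall k, Ex P (Y k) = 0%E) ->
  (* (a) functional CLT in D[0,1] *)
  (exists sigma : R, 0 < sigma /\
     exists (d' : measure_display) (O' : measurableType d')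
            (Q : probability O' R) (W : R -> O' -> R),
       wiener_process01 Q W /\
       weak_conv_D P (partial_sum_process Y) Q (fun t w => sigma * W t w)) ->
  (* (b) *)
  abs_summable_int (gamma P Y) ->
  (* (c) *)
  (exists M : R, forall (h : int) (N : nat),
     \sum_(r < (N + N).+1) \sum_(s < (N + N).+1)
        `|kappa P Y h (r%:Z - N%:Z) (s%:Z - N%:Z)| <= M) ->
  (forall n, (0 < q n)%N) ->
  (forall M : nat, \forall n \near \oo, (M <= q n)%N) ->
  (fun n : nat => (q n)%:R / n%:R : R) @ \oo --> 0 ->
  forall (d'' : measure_display) (O'' : measurableType d'')
         (Q : probability O'' R) (B : R -> O'' -> R),
    brownian_bridge01 Q B ->
    conv_dist P (Tn mu Y q) Q
      (fun w => sup [set `|B t w| | t in `[0, 1]]).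
Proof.
move=> HY _ [sigma [sigma0 [dW [OW [Q [W [HW clt]]]]]]] [G HG] [K HK] _ q_oo q_small.
move=> dB OB Q'' B HB g cg [M gM].
have mV := bridge_sup_measurable HB.
have mg : measurable_fun setT g by exact: continuous_measurable_fun.
have L1g e (T : measurableType e) (P0 : probability T R) Z :
    measurable_fun setT Z -> L1 P0 (fun w => g (Z w)).
  by move=> mZ; apply: (@L1_bounded _ _ _ _ _ M) => //; exact: measurableT_comp.
rewrite (EFin_EE (L1g _ _ Q'' _ mV)); apply/fine_cvgP; split.
  (* Finiteness is needed only eventually; from n = 1 on, [TnE] gives the measurability of [Tn]. *)
  exists 1%N => // n /= n0; apply: integrable_fin_num => //.
  exact: L1g (Tn_measurable HY mu q n0).
exact: (Tn_EE_cvg HY HW HB sigma0 clt HG HK mu q_oo q_small cg gM).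
Qed.
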